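(* Let $k,m\ge 1$ and let $\lambda$ be an integer partition with largest part $\lambda_1$ and with $\ell(\lambda)$ nonzero parts, such that $k\ge\lambda_1+\ell(\lambda)-2$. Then the super-Schur polynomial $s_\lambda(x_1,\dots,x_k;y_1,\dots,y_m)$ can be computed by a subtraction-free arithmetic circuit of size $O((k+m)^3)$ (with an absolute implied constant).
   Context: Subtraction-free circuits: an arithmetic circuit is a directed acyclic network whose gates each perform one binary arithmetic operation; its inputs are the variables and arbitrary positive integer scalars, and it outputs a rational function in the variables. It is subtraction-free if every gate is an addition, a multiplication or a division (no subtraction gates, no negative scalars). The size of a circuit is its number of gates. Super-Schur functions: for two infinite sequences of indeterminates $x_1,x_2,\dots$ and $y_1,y_2,\dots$, define the formal power series $$s_\lambda(x_1,x_2,\dots;y_1,y_2,\dots)=\sum_{T}\ \prod_{s\in\lambda}\bigl(x_{T(s)}+y_{T(s)+C(s)}\bigr),$$ where the sum is over all semistandard Young tableaux $T$ of shape $\lambda$ with positive integer entries (weakly increasing along rows, strictly increasing down columns), the product is over all boxes $s$ of the Young diagram of $\lambda$, $T(s)$ is the entry of $T$ in box $s$, and $C(s)=j-i$ if $s$ lies in row $i$ and column $j$ (so $T(s)+C(s)$ is always a positive integer). In finitely many variables, $$s_\lambda(x_1,\dots,x_k;y_1,\dots,y_m)=s_\lambda(x_1,x_2,\dots;y_1,y_2,\dots)\big|_{x_{k+1}=x_{k+2}=\cdots=y_{m+1}=y_{m+2}=\cdots=0}.$$ *)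

(* Defs.v *)
From mathcomp Require Import all_boot all_algebra.
From mathcomp Require Import boolp classical_sets functions cardinality fsbigop.
From mathcomp.multinomials Require Import mpoly.

Set Implicit Arguments.
Unset Strict Implicit.
Unset Printing Implicit Defensive.

Import GRing.Theory.
Local Open Scope ring_scope.

Variant arith_op := OpAdd | OpSub | OpMul | OpDiv.

(* [Const c] is the scalar c + 1, so that scalars are exactly the positive
   integers.  [Wire j] is the output of the j-th gate (counted from 0). *)
Variant operand (n : nat) :=
  | Var of 'I_n
  | Const of nat
  | Wire of nat.

Arguments Const {n} c.
Arguments Wire {n} j.

Record gate (n : nat) := Gate {
  gate_op : arith_op;
  gate_lhs : operand n;
  gate_rhs : operand n
}.

(* The gates of the network are listed in a topological order. *)
Record circuit (n : nat) := Circuit {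
  gates : seq (gate n);
  output : operand n
}.

Definition circuit_size n (C : circuit n) : nat := size (gates C).

Definition is_sub (o : arith_op) : bool := if o is OpSub then true else false.

Definition subtraction_free n (C : circuit n) : bool :=
  ~~ has (fun g => is_sub (gate_op g)) (gates C).

Section Evaluation.
Variables (n : nat) (K : fieldType) (v : 'I_n -> K).

Definition op_eval (o : arith_op) (a b : K) : option K :=
  match o with
  | OpAdd => Some (a + b)
  | OpSub => Some (a - b)
  | OpMul => Some (a * b)
  | OpDiv => if b == 0 then None else Some (a / b)
  end.

(* [vals] lists the values of the gates already evaluated; an operand that
   refers to any other gate has no value, which enforces acyclicity. *)
Definition operand_eval (vals : seq K) (a : operand n) : option K :=
  match a with
  | Var i => Some (v i)
  | Const c => Some c.+1%:R
  | Wire j => onth vals j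
  end.

Definition gate_eval (vals : seq K) (g : gate n) : option K :=
  if operand_eval vals (gate_lhs g) is Some a then
    if operand_eval vals (gate_rhs g) is Some b then op_eval (gate_op g) a b
    else None
  else None.

Fixpoint gates_eval (vals : seq K) (gs : seq (gate n)) : option (seq K) :=
  if gs is g :: gs' then
    if gate_eval vals g is Some a then gates_eval (rcons vals a) gs' else None
  else Some vals.

Definition circuit_eval (C : circuit n) : option K :=
  if gates_eval [::] (gates C) is Some vals then operand_eval vals (output C)
  else None.

End Evaluation.

Definition computes n (C : circuit n) (f : {fraction {mpoly rat[n]}}) : Prop :=
  circuit_eval (fun i : 'I_n => tofrac ('X_i : {mpoly rat[n]})) C = Some f.

Definition is_partition (la : seq nat) : bool :=
  sorted geq la && (0%N \notin la).

(* A tableau is the sequence of its rows; rows and columns are numbered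
   from 0, while entries are positive integers. *)
Definition entry (T : seq (seq nat)) (i j : nat) : nat :=
  nth 0%N (nth [::] T i) j.

Definition semistandard (la : seq nat) (T : seq (seq nat)) : Prop :=
  [/\ shape T = la,
      forall i j, (j < nth 0 la i)%N -> (0 < entry T i j)%N,
      forall i j, (j.+1 < nth 0 la i)%N -> (entry T i j <= entry T i j.+1)%N
    & forall i j, (j < nth 0 la i.+1)%N -> (entry T i j < entry T i.+1 j)%N].

(* The sequences x and y are indexed from 1: the values x 0 and y 0 are never
   used.  The subtraction of naturals does not truncate, because column
   strictness gives i < entry T i j. *)
Definition tableau_weight (R : comNzRingType) (x y : nat -> R) (la : seq nat)
    (T : seq (seq nat)) : R :=
  \prod_(i < size la) \prod_(j < nth 0%N la i)
    (x (entry T i j) + y (entry T i j + j - i)%N).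

(* [\sum_(T \in A) F T] is the sum of the nonzero F T with T in A when there are
   finitely many of them (and 0 otherwise). *)
Definition super_schur (R : comNzRingType) (x y : nat -> R) (la : seq nat) : R :=
  \sum_(T \in [set T | semistandard la T]%classic) tableau_weight x y la T.

Definition finite_vars (R : nzRingType) (n : nat) (X : 'I_n -> R) (i : nat) : R :=
  if i is i'.+1 then oapp X 0 (insub i') else 0.

Definition schur_x k m : nat -> {mpoly rat[k + m]} :=
  finite_vars (fun i : 'I_k => 'X_(lshift m i)).

Definition schur_y k m : nat -> {mpoly rat[k + m]} :=
  finite_vars (fun j : 'I_m => 'X_(rshift k j)).

Definition super_schur_poly k m (la : seq nat) : {mpoly rat[k + m]} :=
  super_schur (@schur_x k m) (@schur_y k m) la.

(* The sum defining [super_schur_poly] has finitely many nonzero terms: a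
   tableau with an entry above k + m + size la has weight 0. *)
Lemma tableau_weight_eq0 k m la T i j :
  (i < size la)%N -> (j < nth 0%N la i)%N ->
  (k + m + size la < entry T i j)%N ->
  tableau_weight (@schur_x k m) (@schur_y k m) la T = 0.
Proof.
have fv0 (R : nzRingType) n (X : 'I_n -> R) e : (n < e)%N -> finite_vars X e = 0.
  by case: e => //= e; rewrite ltnS => ne; rewrite insubF // ltnNge ne.
move=> ila jla big; rewrite /tableau_weight.
rewrite (bigD1 (Ordinal ila)) //= (bigD1 (Ordinal jla)) //=.
rewrite /schur_x /schur_y !fv0 ?addr0 ?mul0r //.
- rewrite ltn_subRL; apply: leq_trans (leq_addr _ _); apply: leq_ltn_trans big.
  by rewrite addnC leq_add ?leq_addl // ltnW.
- by apply: leq_ltn_trans big; rewrite -addnA leq_addr.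
Qed.

Lemma super_schur_finite_support k m la :
  finite_set ([set T | semistandard la T] `&`
    tableau_weight (@schur_x k m) (@schur_y k m) la @^-1` [set~ 0])%classic.
Proof.
pose N := (k + m + size la)%N.
pose f (t : (sumn la).-tuple 'I_N.+1) := reshape la (map val t).
apply: (@sub_finite_set _ _ (range f)); last exact/finite_image/finite_finset.
move=> T [[shT _ _ _] wT0].
have szT : size (flatten T) = sumn la by rewrite size_flatten shT.
have leN e : e \in flatten T -> (e <= N)%N.
  case/flattenP => r /(nthP [::]) [i iT <-] /(nthP 0%N) [j jr <-].
  have ila : (i < size la)%N by rewrite -shT size_map.
  rewrite leqNgt; apply/negP => big; apply: wT0.
  apply: (@tableau_weight_eq0 k m la T i j) => //.
  by rewrite -shT (nth_map [::]).
have sz : size (map (@inord N) (flatten T)) == sumn la by rewrite size_map szT.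
exists (Tuple sz) => //; rewrite /f /= -map_comp map_id_in.
  by rewrite -shT flattenK.
by move=> e /leN eN /=; rewrite inordK.
Qed.

(* Main.v *)
Require Import Defs.
From mathcomp Require Import all_boot all_order all_algebra.
From mathcomp Require Import boolp classical_sets fsbigop.
From mathcomp.multinomials Require Import mpoly.
From mathcomp Require Import zify ring.
Local Open Scope ring_scope.

Set Implicit Arguments.
Unset Strict Implicit.
Unset Printing Implicit Defensive.
Import Order.TTheory GRing.Theory Num.Theory.

(** Encode a partition [la] with [p] parts by the strictly decreasing list [J]
    of the numbers [la_i + p - i].  The double Schur polynomial of [J] in
    [x_1, ..., x_p] is the flag minor with rows [J] of the matrix of the values
    [(x_j + y_1) ... (x_j + y_e)], divided by the Vandermonde determinant.  On
    intervals [J] it is a product of factors [x_i + y_j], and a three-term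
    Pluecker relation expresses the values on the windows of a list from which
    one row was deleted by those on the windows of the full list, at a constant
    number of gates per window.  Deleting the rows outside [J] one by one takes
    a cubic number of gates and no subtraction.

    The super-Schur polynomial is the double Schur polynomial with enough
    variables, of which those beyond [x_k] and [y_m] are zero; these zeros would
    make the recursion divide by [0].  So they are replaced by positive
    multiples of a parameter, and the circuit computes, instead of polynomials
    in this parameter, their lowest nonzero coefficients.  All these are
    positive at the point [(1, ..., 1)], so lowest coefficients never cancel in
    a sum.  The bound on [head 0 la + size la] ensures that the final polynomial
    is nonzero when the parameter is [0], hence is its own lowest coefficient. *)

(** * Minors of lists of rows *)

Section RowDet.
Variable R : comNzRingType.
Implicit Types (u v : nat -> R) (s : seq (nat -> R)).

(** Rows are infinite sequences, so that a list of rows of any length has a minor on its first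
    columns. *)
Definition rdet s : R :=
  \det (\matrix_(i < size s, j < size s) nth (fun=> 0) s i j).

Lemma rdetE n s : size s = n ->
  rdet s = \det (\matrix_(i < n, j < n) nth (fun=> 0) s i j).
Proof. by move<-. Qed.

Lemma eq_rdet s s' : size s = size s' ->
  (forall i j, (i < size s)%N -> (j < size s)%N ->
     nth (fun=> 0) s i j = nth (fun=> 0) s' i j) -> rdet s = rdet s'.
Proof.
move=> eq_sz eq_s; rewrite (rdetE (esym eq_sz)); congr (\det _).
by apply/matrixP => i j; rewrite !mxE eq_s.
Qed.

Definition row_cofactor s i j : R :=
  (-1) ^+ (i + j) *
  \det (\matrix_(a < size s, b < size s) nth (fun=> 0) s a (bump j b)).

Lemma rdet_expand_row s1 u s2 :
  rdet (s1 ++ u :: s2) =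
  \sum_(j < (size (s1 ++ s2)).+1) u j * row_cofactor (s1 ++ s2) (size s1) j.
Proof.
have szE : size (s1 ++ u :: s2) = (size (s1 ++ s2)).+1.
  by rewrite !size_cat addnS.
have lt1 : (size s1 < (size (s1 ++ s2)).+1)%N by rewrite size_cat ltnS leq_addr.
rewrite (rdetE szE) (expand_det_row _ (Ordinal lt1)).
apply: eq_bigr => j _; rewrite !mxE /= nth_cat ltnn subnn /=; congr (_ * _).
rewrite /cofactor /row_cofactor; congr (_ * \det _).
apply/matrixP => a b; rewrite !mxE /= !nth_cat /bump.
case: (leqP (size s1) a) => [le_a|lt_a]; last by rewrite add0n lt_a.
by rewrite add1n ltnNge leqW //= subSn.
Qed.

Lemma rdet_move s1 u s2 :
  rdet (s1 ++ u :: s2) = (-1) ^+ size s1 * rdet (u :: s1 ++ s2).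
Proof.
rewrite rdet_expand_row (rdet_expand_row [::]) mulr_sumr.
apply: eq_bigr => j _; rewrite /row_cofactor /= add0n exprD; ring.
Qed.

Lemma rdet_sum (I : Type) (r : seq I) (c : I -> R) (g : I -> nat -> R) s1 s2 :
  rdet (s1 ++ (fun j => \sum_(f <- r) c f * g f j) :: s2) =
  \sum_(f <- r) c f * rdet (s1 ++ g f :: s2).
Proof.
under [RHS]eq_bigr do rewrite rdet_expand_row mulr_sumr.
rewrite exchange_big /= rdet_expand_row; apply: eq_bigr => j _.
by rewrite mulr_suml; apply: eq_bigr => f _; rewrite mulrA.
Qed.

Lemma rdet_sub w u v s1 s2 :
  rdet (s1 ++ (fun j => u j - w * v j) :: s2) =
  rdet (s1 ++ u :: s2) - w * rdet (s1 ++ v :: s2).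
Proof.
rewrite !rdet_expand_row mulr_sumr -sumrB; apply: eq_bigr => j _.
by rewrite mulrBl mulrA.
Qed.

Lemma rdet_dup s1 u s2 s3 : rdet (s1 ++ u :: s2 ++ u :: s3) = 0.
Proof.
set s := s1 ++ _; set a := size s1; set b := (size s1 + size s2).+1.
have szE : size s = (size s1 + size s2 + size s3).+2.
  by rewrite !size_cat /= size_cat /=; lia.
have lta : (a < size s)%N by rewrite szE /a; lia.
have ltb : (b < size s)%N by rewrite szE /b; lia.
apply: (@determinant_alternate _ _ _ (Ordinal lta) (Ordinal ltb)).
  by rewrite -val_eqE /= /a /b; lia.
move=> j; rewrite !mxE /= /s !nth_cat ltnn subnn.
rewrite (_ : b < size s1 = false)%N; last by rewrite /b; lia.
rewrite (_ : b - size s1 = (size s2).+1)%N; last by rewrite /b; lia.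
by rewrite /= nth_cat ltnn subnn.
Qed.

Lemma rdet_expand_last_col s n : size s = n.+1 ->
  rdet s = \sum_(i < n.+1)
    nth (fun=> 0) s i n * ((-1) ^+ (i + n) * rdet (take i s ++ drop i.+1 s)).
Proof.
move=> szs; rewrite (rdetE szs) (expand_det_col _ ord_max).
apply: eq_bigr => i _; rewrite !mxE; congr (_ * (_ * _)).
rewrite (@rdetE n); last first.
  have := ltn_ord i; rewrite size_cat size_drop size_take szs => lti.
  by rewrite lti subSS subnKC.
congr (\det _); apply/matrixP => a b; rewrite !mxE /= nth_cat.
rewrite size_takel ?szs; last by rewrite ltnW.
rewrite /bump [(n <= b)%N]leqNgt ltn_ord /= add0n.
case: (ltnP a i) => [lt_a|le_a]; first by rewrite nth_take.
by rewrite nth_drop add1n addSn subnKC.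
Qed.

Lemma rdet_rcons s u :
  (forall i, (i < size s)%N -> nth (fun=> 0) s i (size s) = 0) ->
  rdet (rcons s u) = u (size s) * rdet s.
Proof.
move=> s0; rewrite (@rdet_expand_last_col _ (size s)) ?size_rcons //.
rewrite big_ord_recr /= big1 => [|i _]; last by rewrite nth_rcons ltn_ord s0 ?mul0r.
rewrite add0r nth_rcons ltnn eqxx -signr_odd oddD addbb mul1r.
by rewrite -cats1 take_size_cat // drop_oversize ?cats0 // size_cat addn1.
Qed.

Lemma rdet_scale_cols (d : nat -> R) s :
  rdet (map (fun u j => d j * u j) s) = (\prod_(j < size s) d j) * rdet s.
Proof.
rewrite (@rdetE (size s)) ?size_map //.
transitivity (\det ((\matrix_(i < size s, j < size s) nth (fun=> 0) s i j) *m
                diag_mx (\row_(j < size s) d j))).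
  congr (\det _); apply/matrixP => i j.
  rewrite mul_mx_diag !mxE (nth_map (fun=> 0)) //; exact: mulrC.
rewrite det_mulmx det_diag mulrC; congr (_ * _).
by apply: eq_bigr => j _; rewrite mxE.
Qed.

(** Append to the rows [a], [r], [c] and those of [L], cut to [n.+2] columns, one more column with
    entries [phi u]. Expanding [phi u] along [u] shows that this column depends linearly on the
    others, so the determinant is zero. Since [phi] vanishes on the rows of [L], expansion along the
    last column has three terms. *)
Lemma rdet_plucker_head a r c L :
  rdet (r :: L) * rdet (a :: c :: L) =
  rdet (a :: L) * rdet (r :: c :: L) + rdet (c :: L) * rdet (a :: r :: L).
Proof.
set n := size L; pose phi u := rdet (u :: L).
pose ext u j := if (j < n.+2)%N then u j else phi u.
have extE s : (size s <= n.+2)%N -> rdet (map ext s) = rdet s.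
  move=> szs; apply: eq_rdet; rewrite size_map // => i j lti ltj.
  by rewrite (nth_map (fun=> 0)) // /ext (leq_trans ltj).
pose M := [seq ext u | u <- a :: r :: c :: L].
have szM : size M = n.+3 by rewrite /= size_map.
have phiL i : (i < n)%N -> phi (nth (fun=> 0) L i) = 0.
  move=> lti; rewrite /phi -{2}(cat_take_drop i L) (drop_nth (fun=> 0)) //.
  exact: (rdet_dup [::]).
(* The last column of [M] is a linear combination of the others. *)
have detM0 : rdet M = 0.
  rewrite (rdetE szM); set Z := (X in \det X).
  pose w : 'cV[R]_n.+3 :=
    \col_j (if (j < n.+1)%N then row_cofactor L 0 j
            else if (j == n.+2 :> nat)%N then -1 else 0).
  have Zw : Z *m w = 0.
    apply/colP => i; rewrite !mxE.
    rewrite (eq_bigr (fun j : 'I_n.+3 =>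
      ext (nth (fun=> 0) (a :: r :: c :: L) i) j * w j 0)); last first.
      by move=> j _; rewrite mxE (nth_map (fun=> 0)).
    set u := nth _ _ i.
    rewrite !big_ord_recr /= !mxE /= !eqxx !ltnn.
    rewrite (_ : (n.+1 == n.+2) = false) ?mulr0 ?addr0; last by lia.
    rewrite (_ : (n.+2 < n.+1)%N = false); last by lia.
    rewrite /ext ltnn mulrN1.
    rewrite /phi (rdet_expand_row [::]) /= big_ord_recr /= -/n.
    rewrite ltnSn (_ : (n < n.+2)%N); last by lia.
    apply/eqP; rewrite subr_eq0; apply/eqP; congr (_ + _).
    apply: eq_bigr => j _; rewrite mxE /=.
    by rewrite (ltn_trans (ltn_ord j)) // (ltn_trans (ltn_ord j)).
  (* Zero divisors are possible, so a nonzero kernel vector alone is not enough: the adjugate gives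
     [\det Z *: w = 0], and the last entry of [w] is [-1]. *)
  have : \adj Z *m (Z *m w) = 0 by rewrite Zw mulmx0.
  rewrite mulmxA mul_adj_mx mul_scalar_mx => /colP/(_ ord_max).
  rewrite !mxE /= eqxx (_ : (n.+2 < n.+1)%N = false); last by lia.
  by rewrite mulrN1 => /eqP; rewrite oppr_eq0 => /eqP.
move: detM0; rewrite (rdet_expand_last_col szM) !big_ord_recl big1 => [|i _]; last first.
  have -> : lift ord0 (lift ord0 (lift ord0 i)) = i.+3 :> nat by [].
  by rewrite [nth _ M _]/= (nth_map (fun=> 0)) // /ext ltnn phiL ?mul0r.
rewrite /= /bump /= ?add1n ?addr0 ?take0 ?drop0 add0n add2n.
rewrite (extE [:: r, c & L]) ?(extE [:: a, c & L]) ?(extE [:: a, r & L]) //.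
rewrite /ext ltnn /phi !exprS.
set A := rdet (a :: L); set B := rdet _; set C := rdet (r :: L); set D := rdet _.
set E := rdet _; set F := rdet _ => e0.
have s2 : (-1) ^+ n * (-1) ^+ n = 1 :> R by rewrite -expr2 sqrr_sign.
have : (-1) ^+ n * (A * B - C * D + E * F) = 0 by rewrite -e0; ring.
move/(congr1 (fun z => (-1) ^+ n * z)); rewrite mulrA s2 mul1r mulr0 => e1.
by apply/eqP; rewrite -subr_eq0 -[0]oppr0 -e1; apply/eqP; ring.
Qed.

(** Reordering the rows multiplies all three products by the same sign. *)
Lemma rdet_plucker a L1 r L2 c :
  rdet (L1 ++ r :: L2) * rdet (a :: L1 ++ L2 ++ [:: c]) =
  rdet (a :: L1 ++ L2) * rdet (L1 ++ r :: L2 ++ [:: c]) +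
  rdet (L1 ++ L2 ++ [:: c]) * rdet (a :: L1 ++ r :: L2).
Proof.
set L := L1 ++ L2; set n := size L.
have swap u v : rdet (u :: v :: L) = - rdet (v :: u :: L).
  by rewrite (rdet_move [:: u] v L) expr1 mulN1r.
have e1 : rdet (L1 ++ r :: L2) = (-1) ^+ size L1 * rdet (r :: L).
  exact: rdet_move.
have e2 : rdet (a :: L1 ++ L2 ++ [:: c]) = (-1) ^+ n * rdet (a :: c :: L).
  by rewrite catA (rdet_move (a :: L) c) cats0 exprS swap; ring.
have e3 : rdet (L1 ++ r :: L2 ++ [:: c]) =
    (-1) ^+ size L1 * (-1) ^+ n * rdet (r :: c :: L).
  by rewrite rdet_move catA (rdet_move (r :: L) c) cats0 exprS swap; ring.
have e4 : rdet (L1 ++ L2 ++ [:: c]) = (-1) ^+ n * rdet (c :: L).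
  by rewrite catA rdet_move cats0.
have e5 : rdet (a :: L1 ++ r :: L2) = (-1) ^+ size L1 * rdet (a :: r :: L).
  by rewrite (rdet_move (a :: L1) r) exprS swap; ring.
rewrite e1 e2 e3 e4 e5.
transitivity ((-1) ^+ size L1 * (-1) ^+ n * (rdet (r :: L) * rdet (a :: c :: L))).
  by ring.
by rewrite rdet_plucker_head; ring.
Qed.
End RowDet.

(** * Alternants and their branching rule *)

Fixpoint staircase (la : seq nat) : seq nat :=
  if la is l :: t then (l + size t)%N :: staircase t else [::].

Lemma size_staircase la : size (staircase la) = size la.
Proof. by elim: la => //= l t ->. Qed.

(* The partitions [mu] with one part less than [la] that interlace it, i.e.
   such that [la / mu] is a horizontal strip. *)
Fixpoint strips (la : seq nat) : seq (seq nat) :=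
  match la with
  | l1 :: ((l2 :: _) as t) =>
      [seq m :: mu | m <- index_iota l2 l1.+1, mu <- strips t]
  | _ => [:: [::]]
  end.

Lemma mem_strips_cons l1 l2 t nu :
  nu \in strips [:: l1, l2 & t] ->
  exists m mu, [/\ nu = m :: mu, (l2 <= m <= l1)%N & mu \in strips (l2 :: t)].
Proof.
case/allpairsP => -[m mu] [/= mi mus ->]; exists m, mu; split => //.
by move: mi; rewrite mem_index_iota ltnS.
Qed.

Lemma size_strips la mu : mu \in strips la -> size mu = (size la).-1.
Proof.
elim: la mu => [|l1 [|l2 t] IH] mu; rewrite ?inE; try by move/eqP->.
by case/mem_strips_cons => m [nu [-> _ /IH /= ->]].
Qed.

Lemma sorted_strips la mu : mu \in strips la -> sorted geq mu.
Proof.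
elim: la mu => [|l1 [|l2 t] IH] mu; rewrite ?inE; try by move/eqP->.
case/mem_strips_cons => m [nu [-> /andP[lem _]]].
case: t IH => [|l3 t] IH nus; first by move: nus; rewrite inE => /eqP ->.
have := IH _ nus; case/mem_strips_cons: nus => m' [nu' [-> /andP[_ le2] _]] /= ->.
by rewrite (leq_trans le2).
Qed.

Section Branching.
Variables (R : comNzRingType) (x y : nat -> R).

Definition gen_power (z : R) e := \prod_(j < e) (z + y j.+1).

Lemma gen_powerS z e : gen_power z e.+1 = gen_power z e * (z + y e.+1).
Proof. by rewrite /gen_power big_ord_recr. Qed.

Definition power_row e : nat -> R := fun j => gen_power (x j.+1) e.

Definition alternant J := rdet (map power_row J).

(** The weight of the boxes of [la / mu] when all contain the entry [size la], with variable [z]: in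
    row [a] and column [j], entry plus content is [size la - a + j]. *)
Definition strip_weight z la mu : R :=
  \prod_(a < size la)
    \prod_(nth 0%N mu a <= j < nth 0%N la a) (z + y (size la - a + j)%N).

(** A sum over Gelfand-Tsetlin patterns, the chains of interlacing partitions that lose one part at
    each step. *)
Fixpoint gt_sum n (la : seq nat) : R :=
  if n is n'.+1 then
    \sum_(mu <- strips la) strip_weight (x n) la mu * gt_sum n' mu
  else 1.

Lemma strip_weight_cons z l la m mu :
  strip_weight z (l :: la) (m :: mu) =
  (\prod_(m <= j < l) (z + y ((size la).+1 + j)%N)) * strip_weight z la mu.
Proof.
by rewrite /strip_weight big_ord_recl /= subn0; congr (_ * _).
Qed.

(* [gen_power t e - W * gen_power t e'] vanishes at [t = z]: this is its
   quotient by [t - z] in the basis of generalized powers. *)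
Lemma gen_power_telescope z l1 l2 s : (l2 <= l1)%N -> exists W, forall t,
  gen_power t (l1 + s.+1) - W * gen_power t (l2 + s) =
  \sum_(m <- index_iota l2 l1.+1)
    (\prod_(m <= j < l1) (z + y (s.+2 + j)%N)) * ((t - z) * gen_power t (m + s)).
Proof.
move=> /subnK <-; elim: (l1 - l2)%N => [|d [W IH]].
  exists (z + y (l2 + s).+1) => t; rewrite add0n addnS gen_powerS.
  by rewrite big_nat1 big_geq //; ring.
(* The last factor [t + y e] of the larger power is split as [(t - z) + (z + y e)]: the first
   summand gives the new last term, the second multiplies the previous identity. *)
exists ((z + y (s.+2 + (d + l2))%N) * W) => t.
rewrite big_nat_recr /=; last by lia.
rewrite (eq_big_nat _ _ (F2 := fun m => (z + y (s.+2 + (d + l2))%N) *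
    ((\prod_(m <= j < d + l2) (z + y (s.+2 + j)%N)) *
     ((t - z) * gen_power t (m + s))))); last first.
  by move=> m /andP[_ lem]; rewrite addSn big_nat_recr //=; ring.
rewrite -mulr_sumr -IH big_geq // mul1r.
rewrite addSn addSn [in LHS]gen_powerS.
rewrite (_ : d + l2 + s.+1 = s.+1 + (d + l2))%N; last by lia.
rewrite (_ : (d + l2).+1 + s = s.+1 + (d + l2))%N; last by lia.
rewrite !addSn; ring.
Qed.

(** The quotient from [gen_power_telescope] at [t = x j.+1]. *)
Definition strip_row z l1 l2 s : nat -> R := fun j =>
  \sum_(m <- index_iota l2 l1.+1)
    (\prod_(m <= i < l1) (z + y (s.+2 + i)%N)) * power_row (m + s) j.

Fixpoint strip_rows z (la : seq nat) : seq (nat -> R) :=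
  match la with
  | l1 :: ((l2 :: t') as t) =>
strip_row z l1 l2 (size t') :: strip_rows z t
  | _ => [::]
  end.

Lemma strip_rows_cons z l1 l2 t :
  strip_rows z [:: l1, l2 & t] =
  strip_row z l1 l2 (size t) :: strip_rows z (l2 :: t).
Proof. by []. Qed.

Lemma size_strip_rows z la : size (strip_rows z la) = (size la).-1.
Proof. by elim: la => // l1 [|l2 t] //= ->. Qed.

(** Subtracting from each row a multiple of the next one keeps the determinant and, by
    [gen_power_telescope], makes column [j] divisible by [x j.+1 - z] outside the last row. *)
Lemma alternant_eliminate z pre l la : sorted geq (l :: la) ->
  rdet (pre ++ map power_row (staircase (l :: la))) =
  rdet (pre ++ rcons (map (fun u j => (x j.+1 - z) * u j) (strip_rows z (l :: la)))
                     (power_row (last l la))).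
Proof.
elim: la l pre => [|l2 t IH] l1 pre; first by rewrite /= addn0.
case/andP => le21 srt.
have [W HW] := gen_power_telescope z (size t) le21.
rewrite -[staircase (l1 :: _)]/((l1 + (size t).+1)%N :: staircase (l2 :: t)).
rewrite strip_rows_cons map_cons rcons_cons -[in RHS]cat_rcons.
rewrite -[last l1 _]/(last l2 t) -(IH l2 _ srt) cat_rcons.
set g := (fun j => (x j.+1 - z) * _).
have -> : g = fun j => power_row (l1 + (size t).+1) j -
                       W * power_row (l2 + size t) j.
  apply: funext => j; rewrite HW /g mulr_sumr; apply: eq_bigr => m _.
  by rewrite !mulrA [(_ - z) * _]mulrC.
by rewrite rdet_sub /= (rdet_dup _ _ [::]) mulr0 subr0.
Qed.

(** Linearity in every row amounts to choosing a number between each two consecutive parts, that is,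
    a strip. The factor in front is the weight of the last row of the diagram, which lies in the
    strip entirely. *)
Lemma strip_rows_expand z pre l la :
  gen_power z (last l la) * rdet (pre ++ strip_rows z (l :: la)) =
  \sum_(mu <- strips (l :: la))
    strip_weight z (l :: la) mu * rdet (pre ++ map power_row (staircase mu)).
Proof.
elim: la l pre => [|l2 t IH] l1 pre.
  rewrite /= big_seq1 /strip_weight big_ord1 /= subn0; congr (_ * _).
  by rewrite big_mkord; apply: eq_bigr.
rewrite strip_rows_cons rdet_sum mulr_sumr.
rewrite [strips _]/= big_allpairs_dep /=; apply: eq_bigr => m _.
rewrite mulrCA -cat_rcons IH mulr_sumr; apply: eq_big_seq => mu mus.
by rewrite strip_weight_cons /= (size_strips mus) cat_rcons mulrA.
Qed.

(** With [z] the last variable, the last column is zero outside the last row. The determinant thus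
    loses a row and a column, and the factors [x j.+1 - z] come out of the other columns. *)
Lemma alternant_branch la : sorted geq la -> (0 < size la)%N ->
  alternant (staircase la) =
  (\prod_(j < (size la).-1) (x j.+1 - x (size la))) *
  \sum_(mu <- strips la) strip_weight (x (size la)) la mu * alternant (staircase mu).
Proof.
case: la => // l la srt _; set z := x _.
rewrite /alternant (alternant_eliminate z [::] srt) cat0s rdet_rcons; last first.
  move=> i; rewrite size_map => lti; rewrite (nth_map (fun=> 0)) //.
  by rewrite size_strip_rows /= subrr mul0r.
rewrite rdet_scale_cols size_map size_strip_rows mulrCA.
by rewrite -(strip_rows_expand z [::]).
Qed.

Definition vandermonde n : R :=
  \prod_(i < n) \prod_(j < i) (x j.+1 - x i.+1).

Lemma alternantE la : sorted geq la ->
  alternant (staircase la) = vandermonde (size la) * gt_sum (size la) la.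
Proof.
move En : (size la) => n; elim: n la En => [|n IH] la sz_la srt.
  move/size0nil: sz_la => ->.
  by rewrite /alternant /rdet det_mx00 /vandermonde big_ord0 mulr1.
rewrite alternant_branch ?sz_la // /vandermonde big_ord_recr /= -/(vandermonde n).
rewrite [_ n * _]mulrC -mulrA; congr (_ * _).
rewrite mulr_sumr; apply: eq_big_seq => mu mus.
rewrite IH ?(sorted_strips mus) ?(size_strips mus) ?sz_la //.
ring.
Qed.

End Branching.

(** * Double Schur polynomials of strictly decreasing lists *)

Fixpoint unstaircase (J : seq nat) : seq nat :=
  if J is e :: t then (e - size t)%N :: unstaircase t else [::].

Lemma size_unstaircase J : size (unstaircase J) = size J.
Proof. by elim: J => //= e J ->. Qed.

Lemma staircaseK : cancel staircase unstaircase.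
Proof. by elim=> //= l t ->; rewrite size_staircase addnK. Qed.

Lemma unstaircaseK J : sorted gtn J -> staircase (unstaircase J) = J.
Proof.
suff {J} H J b : path gtn b J -> (size J <= b)%N /\ staircase (unstaircase J) = J.
  by case: J => //= e J /H [le ->]; rewrite size_unstaircase subnK.
elim: J b => //= e J IH b /andP[/= lt /IH [le ->]].
by rewrite size_unstaircase subnK // (leq_ltn_trans le).
Qed.

Lemma sorted_unstaircase J : sorted gtn J -> sorted geq (unstaircase J).
Proof.
case: J => //= e J; elim: J e => //= e' J IH e /andP[/= lt /IH ->].
by rewrite andbT; lia.
Qed.

Lemma sorted_staircase la : sorted geq la -> sorted gtn (staircase la).
Proof.
case: la => //= l la; elim: la l => //= l' la IH l /andP[/= le /IH ->].
by rewrite andbT; lia.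
Qed.

Lemma staircase_nseq p e : staircase (nseq p e) = rev (iota e p).
Proof.
elim: p => // p IH.
by rewrite -addn1 iotaD rev_cat /= -IH addn1 /= size_nseq.
Qed.

(** Unlike the quotient of an alternant by the Vandermonde determinant, the sum makes sense over any
    commutative ring and commutes with morphisms. *)
Definition schur_of (R : comNzRingType) (x y : nat -> R) (J : seq nat) : R :=
  gt_sum x y (size J) (unstaircase J).

(** A rectangle has a single strip, the rectangle with one row less. *)
Lemma gt_sum_nseq (R : comNzRingType) (x y : nat -> R) p e :
  gt_sum x y p (nseq p e) = \prod_(i < p) gen_power y (x i.+1) e.
Proof.
elim: p => [|p IH]; first by rewrite big_ord0.
rewrite [RHS]big_ord_recr [RHS]mulrC -IH.
rewrite -[LHS]/(\sum_(mu <- _) _).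
have -> : strips (nseq p.+1 e) = [:: nseq p e].
  elim: p {IH} => // p /= ->.
  by rewrite /index_iota subSnn.
rewrite big_seq1; congr (_ * _); move: (x p.+1) => z.
elim: p {IH} => [|p IH] /=.
  by rewrite /strip_weight big_ord1 /= big_mkord; apply: eq_bigr.
by rewrite strip_weight_cons /= big_geq // mul1r IH.
Qed.

Lemma schur_of_interval (R : comNzRingType) (x y : nat -> R) e p :
  schur_of x y (rev (iota e p)) = \prod_(i < p) gen_power y (x i.+1) e.
Proof.
by rewrite /schur_of -staircase_nseq staircaseK size_staircase size_nseq gt_sum_nseq.
Qed.

(** Each of the three products pairs a list of [n.+1] rows with one of [n.+2] rows, so the same
    nonzero product of two Vandermonde determinants cancels from the Pluecker relation of the
    alternants. *)
Lemma schur_of_three_term (R : idomainType) (x y : nat -> R) a L1 r L2 c :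
  (forall i j, (0 < j < i)%N -> x j != x i) ->
  sorted gtn (a :: L1 ++ r :: L2 ++ [:: c]) ->
  schur_of x y (L1 ++ r :: L2) * schur_of x y (a :: L1 ++ L2 ++ [:: c]) =
  schur_of x y (a :: L1 ++ L2) * schur_of x y (L1 ++ r :: L2 ++ [:: c]) +
  schur_of x y (L1 ++ L2 ++ [:: c]) * schur_of x y (a :: L1 ++ r :: L2).
Proof.
move=> xneq srt; set n := size (L1 ++ L2).
have vn0 m : vandermonde x m != 0.
  apply/prodf_neq0 => i _; apply/prodf_neq0 => j _; rewrite subr_eq0.
  by apply: xneq; have := ltn_ord j.
have altE J m : subseq J (a :: L1 ++ r :: L2 ++ [:: c]) -> size J = m ->
    alternant x y J = vandermonde x m * schur_of x y J.
  move=> sub szJ; have srtJ := subseq_sorted (rev_trans ltn_trans) sub srt.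
  rewrite -{1}(unstaircaseK srtJ) alternantE ?sorted_unstaircase //.
  by rewrite size_unstaircase /schur_of szJ.
have subL t : subseq (L1 ++ t) (L1 ++ r :: t) by rewrite subseq_cat2l subseq_cons.
have plucker : alternant x y (L1 ++ r :: L2) * alternant x y (a :: L1 ++ L2 ++ [:: c]) =
    alternant x y (a :: L1 ++ L2) * alternant x y (L1 ++ r :: L2 ++ [:: c]) +
    alternant x y (L1 ++ L2 ++ [:: c]) * alternant x y (a :: L1 ++ r :: L2).
  rewrite /alternant !(map_cat, map_cons); exact: rdet_plucker.
have subc t : subseq t (a :: t) by apply: subseq_cons.
have subac t t' : subseq t t' -> subseq (a :: t) (a :: t') by rewrite /= eqxx.
move: plucker.
rewrite (altE (L1 ++ r :: L2) n.+1); first last.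
- by rewrite /n !size_cat /= addnS.
- apply: subseq_trans (subc _); exact: (cat_subseq _ (prefix_subseq (r :: L2) _)).
rewrite (altE (a :: L1 ++ L2 ++ [:: c]) n.+2); first last.
- by rewrite /n /= !size_cat /= addn1 addnS.
- exact/subac/subL.
rewrite (altE (a :: L1 ++ L2) n.+1) //; last first.
  apply/subac/(subseq_trans (subL _)); exact: (cat_subseq _ (prefix_subseq (r :: L2) _)).
rewrite (altE (L1 ++ r :: L2 ++ [:: c]) n.+2); first last.
- by rewrite /n !size_cat /= size_cat /= addn1 !addnS.
- exact: subc.
rewrite (altE (L1 ++ L2 ++ [:: c]) n.+1); first last.
- by rewrite /n !size_cat /= addn1 !addnS.
- exact: subseq_trans (subL _) (subc _).
rewrite (altE (a :: L1 ++ r :: L2) n.+2); first last.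
- by rewrite /n /= !size_cat /= !addnS.
- apply/subac; exact: (cat_subseq _ (prefix_subseq (r :: L2) _)).
move=> e; apply: (mulfI (mulf_neq0 (vn0 n.+1) (vn0 n.+2))).
rewrite mulrDr.
transitivity (vandermonde x n.+1 * schur_of x y (L1 ++ r :: L2) *
       (vandermonde x n.+2 * schur_of x y (a :: L1 ++ L2 ++ [:: c]))); first by ring.
by rewrite e; ring.
Qed.

(** * Subtraction-free computations *)

Section Circuits.
Variables (n : nat) (K : fieldType) (v : 'I_n -> K).
Implicit Types (Z : K -> Prop).

(** A single network provides all values in [Z] at once, so that intermediate results are shared. *)
Definition computable s Z : Prop := exists gs vals,
  [/\ ~~ has (fun g => is_sub (gate_op g)) gs, (size gs <= s)%N,
      gates_eval v [::] gs = Some vals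
    & forall z, Z z -> exists a, operand_eval v vals a = Some z].

Lemma gates_eval_rcons vals gs g :
  gates_eval v vals (rcons gs g) =
  if gates_eval v vals gs is Some vals' then
    if gate_eval v vals' g is Some a then Some (rcons vals' a) else None
  else None.
Proof.
by elim: gs vals => [|h gs IH] vals //=; case: (gate_eval v vals h).
Qed.

Lemma operand_eval_rcons vals w a z :
  operand_eval v vals a = Some z -> operand_eval v (rcons vals w) a = Some z.
Proof.
case: a => //= j e; rewrite -cats1 onth_cat.
by case: ltnP => // /onth_default e'; rewrite e' in e.
Qed.

Lemma computable_sub s s' Z Z' : (s <= s')%N -> (forall z, Z' z -> Z z) ->
  computable s Z -> computable s' Z'.
Proof.
move=> les sub [gs [vals [sf sz ev H]]]; exists gs, vals; split => //.
  exact: leq_trans sz les.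
by move=> z /sub/H.
Qed.

Lemma computable_gate s Z o a b c : ~~ is_sub o -> Z a -> Z b ->
  op_eval o a b = Some c -> computable s Z ->
  computable s.+1 (fun z => Z z \/ z = c).
Proof.
move=> so Za Zb ev_o [gs [vals [sf sz ev H]]].
have [oa ea] := H _ Za; have [ob eb] := H _ Zb.
exists (rcons gs (Gate o oa ob)), (rcons vals c); split.
- by rewrite has_rcons negb_or so.
- by rewrite size_rcons.
- by rewrite gates_eval_rcons ev /gate_eval /= ea eb ev_o.
- move=> z [/H [d ed]|->]; first by exists d; exact: operand_eval_rcons.
  exists (Wire (size vals)); rewrite /= -cats1 onth_cat ltnn subnn //.
Qed.

(** Formulas with leaves in [Z], indexed by their number of operations. Nothing is shared within a
    formula; sharing arises when its value joins the network. *)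
Inductive derivable Z : nat -> K -> Prop :=
| DerIn z : Z z -> derivable Z 0 z
| DerOp o a b c p q : ~~ is_sub o -> op_eval o a b = Some c ->
    derivable Z p a -> derivable Z q b -> derivable Z (p + q).+1 c.

Lemma derivable_sub Z Z' p z :
  (forall w, Z w -> Z' w) -> derivable Z p z -> derivable Z' p z.
Proof.
move=> sub; elim=> [w Zw|o a b c p' q so ev _ Ha _ Hb]; last first.
  exact: DerOp so ev Ha Hb.
by apply/DerIn/sub.
Qed.

Lemma computable_derivable s Z d z :
  derivable Z d z -> computable s Z -> computable (s + d) (fun w => Z w \/ w = z).
Proof.
move=> der; pose incl Z' := forall w, Z w -> Z' w.
suff H Z' s' : incl Z' -> computable s' Z' ->
    computable (s' + d) (fun w => Z' w \/ w = z) by exact: H.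
elim: der Z' s' => {d z} [z Zz|o a b c p q so ev _ IHa _ IHb] Z' s' sub cmp.
  by apply: computable_sub cmp => [|w [|->]] //; [rewrite addn0|exact: sub].
have sub1 : incl (fun w => Z' w \/ w = a) by move=> w Zw; left; exact: sub.
have := IHb _ _ sub1 (IHa _ _ sub cmp).
move/(computable_gate so (or_introl (or_intror erefl)) (or_intror erefl) ev).
apply: computable_sub; first by rewrite addnS addnA.
by move=> w [Zw|->]; [left; left; left|right].
Qed.

Lemma computable_sequence s Z N d (f : nat -> K) :
  (forall i, (i < N)%N -> exists2 e, (e <= d)%N &
     derivable (fun z => Z z \/ exists2 j, (j < i)%N & z = f j) e (f i)) ->
  computable s Z ->
  computable (s + d * N) (fun z => Z z \/ exists2 j, (j < N)%N & z = f j).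
Proof.
move=> der cmp; elim: N der => [|N IH] der.
  apply: computable_sub cmp; first by rewrite leq_addr.
  by move=> z [//|[]].
have [|e le_e der_N] := der N _; first by [].
have := computable_derivable der_N (IH (fun i lt => der i (ltnW lt))).
apply: computable_sub; first by rewrite mulnS; lia.
move=> z [Zz|[j]]; first by left; left.
rewrite ltnS leq_eqVlt => /orP[/eqP-> ->|lt ->]; first by right.
by left; right; exists j.
Qed.

(** The grid is filled row by row: the cell [(i, j)] is number [i * M + j] of a sequence. *)
Lemma computable_grid s Z N M d (f : nat -> nat -> K) :
  (forall i j, (i < N)%N -> (j < M)%N -> exists2 e, (e <= d)%N &
     derivable (fun z => Z z \/ exists i' j',
        [/\ ((i' < i) || (i' <= i) && (j' < j))%N, (j' < M)%N & z = f i' j'])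
        e (f i j)) ->
  computable s Z ->
  computable (s + d * (N * M))
    (fun z => Z z \/ exists i j, [/\ (i < N)%N, (j < M)%N & z = f i j]).
Proof.
move=> der cmp.
have [->|M0] := posnP M.
  apply: computable_sub cmp => [|z [//|[i [j []]]]] //; exact: leq_addr.
have idx i j : (j < M)%N -> ((i * M + j) %/ M = i)%N /\ ((i * M + j) %% M = j)%N.
  by move=> ltj; rewrite divnMDl // divn_small // addn0 modnMDl modn_small.
have := @computable_sequence s Z (N * M) d (fun t => f (t %/ M)%N (t %% M)%N) _ cmp.
case=> [t lt_t|gs [vals H]].
  have ltd : (t %/ M < N)%N by rewrite ltn_divLR.
  have ltm : (t %% M < M)%N by rewrite ltn_mod.
  have [e le_e de] := der _ _ ltd ltm.
  exists e => //.
  apply: derivable_sub de => w [Zw|[i' [j' [lt_ij ltj ->]]]]; first by left.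
  right; exists (i' * M + j')%N; last by have [-> ->] := idx i' j' ltj.
  have e_t := divn_eq t M.
  rewrite e_t; move: lt_ij => /orP[lti|/andP[lei ltj']].
    have : (i'.+1 * M <= t %/ M * M)%N by rewrite leq_mul2r lti orbT.
    by rewrite mulSn; lia.
  have : (i' * M <= t %/ M * M)%N by rewrite leq_mul2r lei orbT.
  lia.
exists gs, vals; case: H => sf sz ev H; split => // z Hz; apply: H.
case: Hz => [Zz|[i [j [lti ltj ->]]]]; first by left.
right; exists (i * M + j)%N; last by have [-> ->] := idx i j ltj.
have : (i.+1 * M <= N * M)%N by rewrite leq_mul2r lti orbT.
by rewrite mulSn; lia.
Qed.

Lemma computable_inputs :
  computable 0 (fun z => (exists i, z = v i) \/ exists c, z = c.+1%:R).
Proof.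
exists [::], [::]; split => // z [[i ->]|[c ->]]; first by exists (Var i).
by exists (Const c).
Qed.

Lemma computable_circuit s Z z : computable s Z -> Z z ->
  exists C : circuit n,
    [/\ subtraction_free C, circuit_eval v C = Some z & (circuit_size C <= s)%N].
Proof.
case=> gs [vals [sf sz ev H]] /H [a ea]; exists (Circuit gs a); split => //.
by rewrite /circuit_eval /= ev.
Qed.

End Circuits.

(** * Lowest coefficients of polynomials *)

Section LowestCoefficient.
Variable K : fieldType.
Implicit Types f g q : {poly K}.

Definition low_coef f : K := (f %/ 'X^(mup 0 f)).[0].

Lemma low_coef0 : low_coef 0 = 0.
Proof. by rewrite /low_coef div0p horner0. Qed.

Lemma low_coefE q d : q.[0] != 0 -> low_coef (q * 'X^d) = q.[0].
Proof.
move=> q0; rewrite /low_coef mupMr //.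
have -> : mup 0 ('X^d : {poly K}) = d.
  by have := mup_XsubCX d 0 (0 : K); rewrite subr0 eqxx.
by rewrite mulpK // -size_poly_eq0 size_polyXn.
Qed.

Lemma low_coef_factor f : f != 0 ->
  exists q d, f = q * 'X^d /\ q.[0] != 0.
Proof.
move=> f0; have [d [q]] := multiplicity_XsubC f 0.
by rewrite f0 /= subr0 => q0 ->; exists q, d.
Qed.

Lemma low_coef_neq0 f : low_coef f != 0 -> f != 0.
Proof. by apply: contraNneq => ->; rewrite low_coef0. Qed.

Lemma low_coefM f g : low_coef (f * g) = low_coef f * low_coef g.
Proof.
have [->|f0] := eqVneq f 0; first by rewrite !(mul0r, low_coef0).
have [->|g0] := eqVneq g 0; first by rewrite !(mulr0, low_coef0).
have [p [d [-> p0]]] := low_coef_factor f0; have [q [e [-> q0]]] := low_coef_factor g0.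
rewrite mulrACA -exprD !low_coefE ?hornerM //.
by rewrite mulf_neq0.
Qed.

Lemma low_coefC c : low_coef c%:P = c.
Proof.
have [->|c0] := eqVneq c 0; first exact: low_coef0.
by rewrite -[c%:P]mulr1 -(expr0 'X) low_coefE hornerC.
Qed.

Lemma low_coef_horner f : f.[0] != 0 -> low_coef f = f.[0].
Proof. by move=> f0; rewrite -{1}[f]mulr1 -(expr0 'X) low_coefE. Qed.

(** The cases are equal orders of vanishing at [0], where the nonzero sum excludes cancellation, and
    a smaller order of [f] or of [g]. *)
Lemma low_coefD f g :
  low_coef f != 0 -> low_coef g != 0 -> low_coef f + low_coef g != 0 ->
  [\/ low_coef (f + g) = low_coef f + low_coef g,
      low_coef (f + g) = low_coef f | low_coef (f + g) = low_coef g].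
Proof.
move=> /low_coef_neq0/low_coef_factor[p [d [-> p0]]].
move=> /low_coef_neq0/low_coef_factor[q [e [-> q0]]].
rewrite !low_coefE // => pq0.
have tail r k : (0 < k)%N -> (r * 'X^k).[0] = 0 :> K.
  by move=> k0; rewrite hornerM hornerXn expr0n -[_ == 0]negbK -lt0n k0 mulr0.
case: (ltngtP d e) => [lt|lt|->].
- constructor 2; rewrite -(subnK (ltnW lt)) exprD mulrA -mulrDl.
  by rewrite low_coefE hornerD tail ?addr0 ?subn_gt0.
- constructor 3; rewrite -(subnK (ltnW lt)) exprD mulrA -mulrDl.
  by rewrite low_coefE hornerD tail ?add0r ?subn_gt0.
- by constructor 1; rewrite -mulrDl low_coefE hornerD.
Qed.

End LowestCoefficient.

(** * The table of window minors *)

Definition window (J L : seq nat) := exists s1 s2, L = s1 ++ J ++ s2.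

Lemma window_refl L : window L L.
Proof. by exists [::], [::]; rewrite cats0. Qed.

Lemma window_trans J1 J2 J3 : window J1 J2 -> window J2 J3 -> window J1 J3.
Proof.
case=> s1 [s2 ->] [t1 [t2 ->]]; exists (t1 ++ s1), (s2 ++ t2).
by rewrite -!catA.
Qed.

Lemma window_iota J n : window J (rev (iota 0 n)) ->
  exists e p, [/\ J = rev (iota e p), (e <= n)%N & (p <= n)%N].
Proof.
case=> s1 [s2 /(congr1 rev)]; rewrite revK !rev_cat -catA => eJ.
have sz := congr1 size eJ; rewrite size_iota !size_cat !size_rev in sz.
exists (size s2), (size J); split; [|lia|lia].
rewrite -[LHS]revK; congr rev.
have := congr1 (fun s => take (size J) (drop (size s2) s)) eJ.
rewrite drop_size_cat ?size_rev // take_size_cat ?size_rev // => <-.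
by rewrite drop_iota take_iota add0n; congr iota; lia.
Qed.

Lemma window_cat L1 L2 J : window J (L1 ++ L2) ->
  [\/ window J L1, window J L2 |
      exists u w, [/\ (u <= size L1)%N, (w <= size L2)%N &
        J = drop (size L1 - u) L1 ++ take w L2]].
Proof.
case=> s1 [s2 eL].
have szL := congr1 size eL; rewrite !size_cat in szL.
have -> : J = take (size J) (drop (size s1) (L1 ++ L2)).
  by rewrite eL drop_size_cat // take_size_cat.
rewrite drop_cat; case: ltnP => [lt1|le1]; last first.
  constructor 2; set a := (_ - _)%N; exists (take a L2), (drop (size J) (drop a L2)).
  by rewrite !cat_take_drop.
rewrite take_cat size_drop; case: ltnP => [lt2|le2].
  constructor 1; exists (take (size s1) L1), (drop (size J) (drop (size s1) L1)).
  by rewrite !cat_take_drop.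
constructor 3; exists (size L1 - size s1)%N, (size J - (size L1 - size s1))%N.
split; [lia|lia|].
by congr (drop _ _ ++ _); lia.
Qed.

Section Table.
Variables (n : nat) (K : fieldType) (v : 'I_n -> K) (P : K -> Prop).
Hypothesis P0 : forall a, P a -> a != 0.
Hypothesis P1 : P 1.
Hypothesis PD : forall a b, P a -> P b -> P (a + b).
Hypothesis PM : forall a b, P a -> P b -> P (a * b).
Hypothesis PV : forall a, P a -> P a^-1.

(** Lowest coefficients are multiplicative, and [low_coefD] leaves three possible formulas, each
    with at most two products, one addition and one division. Which one applies depends only on the
    polynomials, so it is settled when the circuit is built. The predicate [P] abstracts positivity
    and excludes cancellation and division by zero. *)
Lemma low_coef_step (A B C D E X : {poly K}) :
  D * X = A * B + C * E ->
  P (low_coef A) -> P (low_coef B) -> P (low_coef C) -> P (low_coef D) ->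
  P (low_coef E) ->
  P (low_coef X) /\
  forall Z : K -> Prop, Z (low_coef A) -> Z (low_coef B) -> Z (low_coef C) ->
    Z (low_coef D) -> Z (low_coef E) ->
    exists2 e, (e <= 4)%N & derivable Z e (low_coef X).
Proof.
move=> eX pA pB pC pD pE.
have pAB : P (low_coef (A * B)) by rewrite low_coefM; exact: PM.
have pCE : P (low_coef (C * E)) by rewrite low_coefM; exact: PM.
have -> : low_coef X = low_coef (A * B + C * E) / low_coef D.
  by rewrite -eX low_coefM mulrAC divff ?mul1r ?P0.
have low_cases := low_coefD (P0 pAB) (P0 pCE) (P0 (PD pAB pCE)).
split.
  by apply: PM (PV pD); case: low_cases => -> //; exact: PD.
move=> Z zA zB zC zD zE.
have dM F G : Z (low_coef F) -> Z (low_coef G) -> derivable Z 1 (low_coef (F * G)).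
  by move=> zF zG; apply: (@DerOp _ _ OpMul _ _ _ 0 0) (DerIn zF) (DerIn zG);
     rewrite //= low_coefM.
have dV F p : derivable Z p F -> derivable Z p.+1 (F / low_coef D).
  move=> dF; rewrite -[p]addn0; apply: (@DerOp _ _ OpDiv _ _ _ p 0 _ _ dF (DerIn zD)) => //=.
  by rewrite (negPf (P0 pD)).
have dAB := dM _ _ zA zB; have dCE := dM _ _ zC zE.
case: low_cases => ->; [exists 4 => //| |]; [|by exists 2 => //; exact: dV..].
by apply: dV; apply: (@DerOp _ _ OpAdd _ _ _ 1 1) dAB dCE.
Qed.

Variables x y : nat -> {poly K}.
Hypothesis x_neq : forall i j, (0 < j < i)%N -> x j != x i.

Let inputs z := (exists i, z = v i) \/ exists c, z = c.+1%:R.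

Hypothesis P_factor : forall i j, P (low_coef (x i.+1 + y j.+1)).
Hypothesis derivable_factor : forall i j,
  exists2 e, (e <= 1)%N & derivable inputs e (low_coef (x i.+1 + y j.+1)).

Let S J := low_coef (schur_of x y J).

Definition table L z := exists J, window J L /\ z = S J.

Definition positive_table L := forall J, window J L -> P (S J).

Definition interval_coef p e : K :=
  \prod_(i < p) \prod_(j < e) low_coef (x i.+1 + y j.+1).

Lemma interval_coefE p e : S (rev (iota e p)) = interval_coef p e.
Proof.
have lowC : {morph low_coef (K := K) : f g / f * g} by exact: low_coefM.
have low1 : low_coef 1 = 1 :> K by exact: low_coefC.
rewrite /S schur_of_interval (big_morph _ lowC low1); apply: eq_bigr => i _.
by rewrite (big_morph _ lowC low1).
Qed.

Lemma interval_coef_pos p e : P (interval_coef p e).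
Proof.
by apply: big_ind => // i _; apply: big_ind => // j _; exact: P_factor.
Qed.

(** A rectangular product is the product of the rectangles lacking its last row or its last column,
    divided by their intersection and multiplied by the corner factor. This takes two products, one
    division and at most one gate for the corner factor. *)
Lemma computable_intervals N M :
  computable v (4 * (N.+1 * M.+1)) (fun z => exists p e,
    [/\ (p < N.+1)%N, (e < M.+1)%N & z = interval_coef p e]).
Proof.
rewrite -[(4 * _)%N]add0n.
apply: computable_sub (leqnn _) _ (computable_grid (N := N.+1) (M := M.+1)
  (f := interval_coef) _ (computable_inputs v)); first by move=> z; right.
have der1 (Z : K -> Prop) : (forall w, inputs w -> Z w) -> derivable Z 0 1.
  by move=> sub; apply/DerIn/sub; right; exists 0%N.
(* On the border of the grid the product is empty, hence the scalar 1. *)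
move=> [|i] j ltiN ltjM.
  exists 0%N => //; rewrite {2}/interval_coef big_ord0.
  by apply: der1 => w Zw; left.
case: j ltjM => [|j] ltjM.
  exists 0%N => //; rewrite {2}/interval_coef big1; last by move=> k _; rewrite big_ord0.
  by apply: der1 => w Zw; left.
have [e le_e de] := derivable_factor i j.
set Z := fun z : K => _.
have Zold p q : ((p < i.+1) || (p <= i.+1) && (q < j.+1))%N -> (q < M.+1)%N ->
    derivable Z 0 (interval_coef p q).
  by move=> lt1 lt2; apply: DerIn; right; exists p, q.
have IS p q : interval_coef p.+1 q =
    interval_coef p q * \prod_(k < q) low_coef (x p.+1 + y k.+1).
  by rewrite /interval_coef big_ord_recr.
have -> : interval_coef i.+1 j.+1 =
   interval_coef i j.+1 * interval_coef i.+1 j / interval_coef i j *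
   low_coef (x i.+1 + y j.+1).
  rewrite 2!IS big_ord_recr /=; set a := interval_coef i j.
  have a0 : a != 0 := P0 (interval_coef_pos i j).
  by field.
exists (2 + e).+1; first by lia.
apply: (@DerOp _ _ OpMul _ _ _ 2 e isT erefl); last by apply: derivable_sub de => w Zw; left.
have ev : op_eval OpDiv (interval_coef i j.+1 * interval_coef i.+1 j)
    (interval_coef i j) = Some (interval_coef i j.+1 * interval_coef i.+1 j /
    interval_coef i j) by rewrite /= (negPf (P0 (interval_coef_pos i j))).
apply: (@DerOp _ _ OpDiv _ _ _ 1 0 isT ev); last by apply: Zold; lia.
by apply: (@DerOp _ _ OpMul _ _ _ 0 0 isT erefl); apply: Zold; lia.
Qed.

(** Windows of an interval are intervals, whose values are rectangular products. *)
Lemma initial_table N :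
  positive_table (rev (iota 0 N)) /\
  computable v (4 * (N.+1 * N.+1)) (table (rev (iota 0 N))).
Proof.
split=> [J /window_iota [e [p [-> _ _]]]|].
  by rewrite interval_coefE; exact: interval_coef_pos.
apply: computable_sub (leqnn _) _ (computable_intervals N N).
move=> z [J [/window_iota [e [p [-> lee lep]]] ->]].
by exists p, e; rewrite interval_coefE.
Qed.

(** The new windows straddle the deleted row; [Y u w] belongs to the one with [u] entries before it
    and [w] after it. Restoring [r] gives [T u w], a value in the old table. The relation [rel]
    computes [Y u.+1 w.+1] from its two neighbours and from old values, and for [u = 0] or [w = 0]
    the window is an old one. *)
Lemma delete_row L1 r L2 s : sorted gtn (L1 ++ r :: L2) ->
  positive_table (L1 ++ r :: L2) -> computable v s (table (L1 ++ r :: L2)) ->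
  positive_table (L1 ++ L2) /\
  computable v (s + 4 * (size L1 * size L2)) (table (L1 ++ L2)).
Proof.
move=> srt posL cmp; set L := L1 ++ r :: L2.
pose Y u w := schur_of x y (drop (size L1 - u) L1 ++ take w L2).
pose T u w := schur_of x y (drop (size L1 - u) L1 ++ r :: take w L2).
have window1 : window L1 L by exists [::], (r :: L2).
have window2 : window L2 L by exists (rcons L1 r), [::]; rewrite cats0 cat_rcons.
have windowT u w : window (drop (size L1 - u) L1 ++ r :: take w L2) L.
  exists (take (size L1 - u) L1), (drop w L2).
  by rewrite -catA cat_cons cat_take_drop catA cat_take_drop.
have window_l u : window (drop (size L1 - u) L1 ++ take 0 L2) L.
  apply: window_trans window1; exists (take (size L1 - u) L1), [::].
  by rewrite take0 !cats0 cat_take_drop.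
have window_r w : window (drop (size L1 - 0) L1 ++ take w L2) L.
  apply: window_trans window2; exists [::], (drop w L2).
  by rewrite subn0 drop_size cat_take_drop.
have rel u w : (u < size L1)%N -> (w < size L2)%N ->
    T u w * Y u.+1 w.+1 = Y u.+1 w * T u w.+1 + Y u w.+1 * T u.+1 w.
  (* The three-term relation is applied with [a] and [c] the first and last entries of the window of
     [Y u.+1 w.+1]. *)
  move=> ltu ltw; rewrite /T /Y.
  have lt_d : (size L1 - u.+1 < size L1)%N by rewrite ltn_subrL (leq_trans _ ltu).
  have -> : drop (size L1 - u.+1) L1 = nth 0%N L1 (size L1 - u.+1) :: drop (size L1 - u) L1.
    by rewrite (drop_nth 0%N lt_d) subnSK.
  rewrite (take_nth 0%N ltw) -cats1; apply: schur_of_three_term x_neq _.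
  apply: (subseq_sorted (rev_trans ltn_trans)) srt.
  rewrite -cat1s -[L1 in X in subseq _ X](cat_take_drop (size L1 - u.+1)) -catA.
  apply: (@subseq_trans _ (drop (size L1 - u.+1) L1 ++ r :: L2)); last exact: suffix_subseq.
  rewrite (drop_nth 0%N lt_d) subnSK //.
  rewrite /= eqxx subseq_cat2l /= eqxx cats1 -take_nth //; exact: take_subseq.
have posT u w : P (low_coef (T u w)) by exact: posL.
have posY u w : (u <= size L1)%N -> (w <= size L2)%N -> P (low_coef (Y u w)).
  elim: u w => [|u IHu] w; first by move=> _ _; exact: posL.
  elim: w => [|w IHw] ltu ltw; first exact: posL.
  have [] // := low_coef_step (rel u w ltu ltw).
    by apply: IHw => //; exact: ltnW.
  by apply: IHu => //; exact: ltnW.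
have old J : window J L -> table L (S J) by move=> wJ; exists J.
split=> [J /window_cat [wJ|wJ|[u [w [leu lew ->]]]]|].
- by apply: posL; exact: window_trans window1.
- by apply: posL; exact: window_trans window2.
- exact: posY.
pose f u w := low_coef (Y u.+1 w.+1).
apply: computable_sub (leqnn _) _
  (computable_grid (N := size L1) (M := size L2) (f := f) _ cmp).
  move=> z [J [/window_cat [wJ|wJ|[u [w [leu lew ->]]]] ->]].
  - by left; apply/old/(window_trans wJ).
  - by left; apply/old/(window_trans wJ).
  case: u leu => [|u] leu; first by left; exact: old.
  case: w lew => [|w] lew; first by left; exact: old.
  by right; exists u, w.
move=> u w ltu ltw; rewrite {2}/f.
have [_ der] := low_coef_step (rel u w ltu ltw) (posY u.+1 w ltu (ltnW ltw))
  (posT _ _) (posY u w.+1 (ltnW ltu) ltw) (posT _ _) (posT _ _).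
apply: der.
- case: w ltw => [|w] ltw; first by left; exact: old.
  by right; exists u, w; split => //; lia.
- by left; exact: old.
- case: u ltu => [|u] ltu; first by left; exact: old.
  by right; exists u, w; split => //; lia.
- by left; exact: old.
- by left; exact: old.
Qed.

(** [L] is scanned from the left: an entry that heads [I] joins [pre], any other is deleted. Each
    deletion fills a grid of at most [N * N] cells. *)
Lemma delete_rows N s pre L I : (size (pre ++ L) <= N)%N -> sorted gtn (pre ++ L) ->
  subseq I L -> positive_table (pre ++ L) -> computable v s (table (pre ++ L)) ->
  positive_table (pre ++ I) /\
  computable v (s + 4 * (N * N) * size L) (table (pre ++ I)).
Proof.
elim: L s pre I => [|r L IH] s pre I szN srt.
  by rewrite subseq0 => /eqP -> pos cmp; rewrite muln0 addn0.
have del I' : subseq I' L ->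
    positive_table (pre ++ r :: L) -> computable v s (table (pre ++ r :: L)) ->
    positive_table (pre ++ I') /\
    computable v (s + 4 * (N * N) * (size L).+1) (table (pre ++ I')).
  move=> sub pos cmp; have [pos' cmp'] := delete_row srt pos cmp.
  have szN' : (size (pre ++ L) <= N)%N by move: szN; rewrite !size_cat /=; lia.
  have srt' : sorted gtn (pre ++ L).
    apply: (subseq_sorted (rev_trans ltn_trans)) srt.
    by rewrite subseq_cat2l subseq_cons.
  have [pos'' cmp''] := IH _ pre I' szN' srt' sub pos' cmp'.
  split=> //; apply: computable_sub cmp'' => //.
  rewrite mulnS addnA leq_add2r leq_add2l leq_mul2l /=.
  by apply: leq_mul; move: szN; rewrite size_cat /=; lia.
case: I => [|i I] sub; first by apply: del; exact: sub0seq.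
move: sub => /=; case: eqP => [->|_]; last exact: del.
rewrite -!cat_rcons in szN srt * => sub pos cmp.
have [pos' cmp'] := IH _ (rcons pre r) I szN srt sub pos cmp.
split=> //; apply: computable_sub cmp' => //.
by rewrite leq_add2l leq_mul2l leqnSn orbT.
Qed.

Lemma computable_low_schur N I : sorted gtn I -> all (fun i => (i < N)%N) I ->
  P (S I) /\ computable v (4 * (N.+1 * N.+1) + 4 * (N * N) * N) (fun z => z = S I).
Proof.
move=> srtI ltI; have [pos cmp] := initial_table N.
have srt : sorted gtn (rev (iota 0 N)).
  by rewrite rev_sorted; exact: iota_ltn_sorted.
have sub : subseq I (rev (iota 0 N)).
  have -> : I = [seq i <- rev (iota 0 N) | i \in I]; last exact: filter_subseq.
  apply: (irr_sorted_eq (rev_trans ltn_trans) ltnn) => //.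
    exact: (sorted_filter (rev_trans ltn_trans)).
  move=> i; rewrite mem_filter mem_rev mem_iota add0n /=.
  by case: (boolP (i \in I)) => //= /(allP ltI) ->.
have sz0 : (size ([::] ++ rev (iota 0 N)) <= N)%N by rewrite size_rev size_iota.
have [pos' cmp'] := delete_rows sz0 srt sub pos cmp.
split; first exact: pos' (window_refl I).
apply: computable_sub cmp'; first by rewrite size_rev size_iota.
by move=> z ->; exists I; split => //; exact: window_refl.
Qed.

End Table.

(** * Tableaux *)

Lemma nth_strips la mu a : mu \in strips la -> sorted geq la ->
  (nth 0%N la a.+1 <= nth 0%N mu a <= nth 0%N la a)%N.
Proof.
elim: la mu a => [|l1 [|l2 t] IH] mu a; rewrite ?inE; try by move/eqP->; rewrite /= !nth_nil.
case/mem_strips_cons => m [nu [-> /andP[le1 le2] nus]] /andP[_ srt].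
by case: a => [|a] /=; [rewrite le1|exact: IH].
Qed.

Lemma mem_strips la mu : size mu = (size la).-1 ->
  (forall a, (a < size mu)%N -> (nth 0%N la a.+1 <= nth 0%N mu a <= nth 0%N la a)%N) ->
  mu \in strips la.
Proof.
elim: la mu => [|l1 [|l2 t] IH] mu; try by move/size0nil->.
case: mu => // m mu [szmu] H.
apply/allpairsP; exists (m, mu); split => //=.
  by have := H 0%N isT; rewrite mem_index_iota ltnS.
by apply: IH => // a lta; exact: (H a.+1).
Qed.

(** If [T] has [p.-1] rows, the last of the [p] rows is new: [nth] reads it as empty before the
    copies of [p] are appended. *)
Definition add_strip p (la : seq nat) (T : seq (seq nat)) : seq (seq nat) :=
  mkseq (fun a => nth [::] T a ++ nseq (nth 0%N la a - size (nth [::] T a)) p) p.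

(* Rows may be empty: there are always [n] of them, and entries are at most [n]. *)
Fixpoint tableaux n (la : seq nat) : seq (seq (seq nat)) :=
  if n is n'.+1 then [seq add_strip n la T | mu <- strips la, T <- tableaux n' mu]
  else [:: [::]].

Lemma nth_shape (T : seq (seq nat)) i : size (nth [::] T i) = nth 0%N (shape T) i.
Proof.
have [lti|lei] := ltnP i (size T); first by rewrite (nth_map [::]).
by rewrite !nth_default // size_map.
Qed.

Lemma shape_add_strip p la mu T : size la = p -> sorted geq la ->
  mu \in strips la -> shape T = mu -> shape (add_strip p la T) = la.
Proof.
move=> szla srt mus shT; apply: (@eq_from_nth _ 0%N).
  by rewrite size_map size_mkseq.
move=> a; rewrite size_map size_mkseq => lta.
rewrite -nth_shape nth_mkseq // size_cat size_nseq nth_shape shT subnKC //.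
by case/andP: (nth_strips a mus srt).
Qed.

Lemma entry_add_strip p la mu T i j : size la = p ->
  shape T = mu -> (j < nth 0%N la i)%N ->
  entry (add_strip p la T) i j = if (j < nth 0%N mu i)%N then entry T i j else p.
Proof.
move=> szla shT ltj.
have lti : (i < p)%N.
  by rewrite ltnNge -szla; apply/negP => le; rewrite nth_default in ltj.
rewrite /entry nth_mkseq // nth_cat nth_shape shT; case: ltnP => // lej.
by rewrite nth_nseq ltn_sub2r // (leq_ltn_trans lej).
Qed.

Lemma tableau_weight_add_strip (R : comNzRingType) (x y : nat -> R) p la mu T :
  size la = p.+1 -> sorted geq la -> mu \in strips la -> shape T = mu ->
  tableau_weight x y la (add_strip p.+1 la T) =
  strip_weight y (x p.+1) la mu * tableau_weight x y mu T.
Proof.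
move=> szla srt mus shT; have szmu := size_strips mus; rewrite szla /= in szmu.
rewrite /tableau_weight /strip_weight mulrC.
pose F (a : nat) := \prod_(j < nth 0%N mu a) (x (entry T a j) + y (entry T a j + j - a)%N).
(* Row [p] of [mu] has default length [0], so the product may run over all rows of [la]. *)
have -> : \prod_(i < size mu) \prod_(j < nth 0%N mu i)
   (x (entry T i j) + y (entry T i j + j - i)%N) = \prod_(i < size la) F i.
  rewrite szla big_ord_recr szmu /F [nth _ mu p]nth_default ?szmu // big_ord0.
  exact: (esym (mulr1 _)).
rewrite -big_split /=; apply: eq_bigr => a _.
have /andP[_ le_mu] := nth_strips a mus srt.
rewrite -(big_mkord xpredT (fun j =>
  x (entry (add_strip p.+1 la T) a j) + y (entry (add_strip p.+1 la T) a j + j - a)%N)).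
rewrite [LHS](big_cat_nat (leq0n _) le_mu) /=.
congr (_ * _).
  rewrite /F big_mkord; apply: eq_bigr => j _.
  by rewrite (entry_add_strip szla shT) ?ltn_ord // (leq_trans (ltn_ord j)).
apply: eq_big_nat => j /andP[lej ltj].
rewrite (entry_add_strip szla shT) // ltnNge lej /=.
by congr (_ + y _); rewrite -szla addnBAC // ltnW // ltn_ord.
Qed.

Lemma shape_tableaux p la T : size la = p -> sorted geq la ->
  T \in tableaux p la -> shape T = la.
Proof.
elim: p la T => [|p IH] la T szla srt.
  by move/size0nil: szla => ->; rewrite inE => /eqP ->.
case/allpairsPdep => mu [T' [mus T's ->]].
apply: (shape_add_strip szla srt mus).
by apply: IH (sorted_strips mus) T's; rewrite (size_strips mus) szla.
Qed.

Lemma sum_tableaux (R : comNzRingType) (x y : nat -> R) p la :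
  size la = p -> sorted geq la ->
  \sum_(T <- tableaux p la) tableau_weight x y la T = gt_sum x y p la.
Proof.
elim: p la => [|p IH] la szla srt.
  by rewrite /= big_seq1 /tableau_weight szla big_ord0.
rewrite [tableaux _ _]/= big_allpairs_dep /=; apply: eq_big_seq => mu mus.
have szmu : size mu = p by rewrite (size_strips mus) szla.
have srtmu := sorted_strips mus.
rewrite -IH // mulr_sumr; apply: eq_big_seq => T Ts.
exact: tableau_weight_add_strip (shape_tableaux szmu srtmu Ts).
Qed.

(** Undoes the addition of the strip of entries [p.+1]. In a semistandard tableau an entry exceeds
    its row number, so entries up to [p] occur in the first [p] rows only. *)
Definition restrict p (T : seq (seq nat)) : seq (seq nat) :=
  mkseq (fun a => [seq e <- nth [::] T a | (e <= p)%N]) p.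

(** The boxes with the largest entry allowed form a horizontal strip: [restrict] removes them, the
    induction hypothesis applies to the rest, and [add_strip] puts them back. *)
Lemma mem_tableaux p la T : size la = p -> sorted geq la ->
  T \in tableaux p la <->
  semistandard la T /\ forall i j, (j < nth 0%N la i)%N -> (entry T i j <= p)%N.
Proof.
elim: p la T => [|p IH] la T szla srt.
  move/size0nil: szla => ->; rewrite inE; split.
    by move/eqP->; split=> [|i j]; [split=> // i j|]; rewrite nth_nil.
  by case=> -[/(congr1 size) + _ _ _] _; rewrite size_map => /size0nil ->.
split.
  case/allpairsPdep => mu [T' [mus T's ->]].
  have szmu : size mu = p by rewrite (size_strips mus) szla.
  have srtmu := sorted_strips mus.
  have shT' := shape_tableaux szmu srtmu T's.
  have [[_ pos row col] le_p] := (IH mu T' szmu srtmu).1 T's.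
  have ent i j := @entry_add_strip p.+1 la mu T' i j szla shT'.
  split; last first.
    by move=> i j ltj; rewrite ent //; case: ifP => // /le_p/leqW.
  split.
  - exact: shape_add_strip mus shT'.
  - by move=> i j ltj; rewrite ent //; case: ifP => // /pos.
  - move=> i j ltj; rewrite !ent //; last exact: ltnW.
    case: (ltnP j.+1) => [lt1|_]; first by rewrite (ltnW lt1) row.
    by case: ifP => // /le_p/leqW.
  - move=> i j ltj.
    have /andP[le1 le2] := nth_strips i mus srt.
    have ltj' : (j < nth 0%N mu i)%N := leq_trans ltj le1.
    rewrite (ent i j (leq_trans ltj' le2)) (ent i.+1 j ltj) ltj'.
    by case: ifP => [/col|_] //; rewrite ltnS le_p.
case=> -[shT pos row col] le_p.
have szT : size T = p.+1 by rewrite -szla -shT size_map.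
have dec i : (nth 0%N la i.+1 <= nth 0%N la i)%N.
  have [lti|lei] := ltnP i.+1 (size la); last by rewrite nth_default.
  exact: (sortedP 0%N srt).
have ent_gt i j : (j < nth 0%N la i)%N -> (i < entry T i j)%N.
  elim: i => [|i IHi] ltj; first exact: pos.
  exact: leq_ltn_trans (IHi (leq_trans ltj (dec i))) (col i j ltj).
(* The row is weakly increasing and bounded by [p.+1], so the entries [p.+1] come last. *)
have rowE a : nth [::] T a = [seq e <- nth [::] T a | (e <= p)%N] ++
     nseq (nth 0%N la a - size [seq e <- nth [::] T a | (e <= p)%N]) p.+1.
  rewrite -shT -nth_shape.
  have srt_row : sorted leq (nth [::] T a).
    by apply/(sortedP 0%N) => j ltj; apply: row; rewrite -shT -nth_shape.
  have all_row : all (fun e => (e <= p.+1)%N) (nth [::] T a).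
    by apply/(all_nthP 0%N) => j ltj; apply: le_p; rewrite -shT -nth_shape.
  elim: (nth [::] T a) srt_row all_row => //= e s IHs srt_s /andP[le_e all_s].
  case: (leqP e p) => [_|lt_e] /=.
    by rewrite subSS -IHs ?(path_sorted srt_s).
  have s_eq : s = nseq (size s) p.+1.
    apply/all_pred1P/allP => f fs; rewrite /= eqn_leq (allP all_s _ fs) /=.
    by apply: leq_trans lt_e _; exact: (allP (order_path_min leq_trans srt_s)).
  have -> : [seq e <- s | (e <= p)%N] = [::].
    by rewrite s_eq; elim: (size s) => //= q ->; rewrite ltnn.
  have -> : e = p.+1 by apply/eqP; rewrite eqn_leq le_e.
  by rewrite subn0 /= -s_eq.
have ent_ge i j : (j < nth 0%N la i)%N ->
    (j < size [seq e <- nth [::] T i | (e <= p)%N])%N = (entry T i j <= p)%N.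
  move=> ltj; rewrite /entry [in RHS]rowE nth_cat; case: ltnP => lej.
    by have := mem_nth 0%N lej; rewrite mem_filter => /andP[-> _].
  by rewrite nth_nseq ltn_sub2r ?ltnn // (leq_ltn_trans lej).
pose T' := restrict p T; pose mu := shape T'.
have szmu : size mu = p by rewrite size_map size_mkseq.
have nth_T' a : nth [::] T' a = [seq e <- nth [::] T a | (e <= p)%N].
  have [lta|lea] := ltnP a p; first by rewrite nth_mkseq.
  rewrite nth_default ?size_mkseq //; apply/esym/eqP; rewrite -size_eq0 -leqn0 leqNgt.
  apply/negP => gt0.
  have lt0 : (0 < nth 0%N la a)%N.
    by rewrite -shT -nth_shape (leq_trans gt0) // size_filter count_size.
  by move: gt0; rewrite (ent_ge _ _ lt0) leqNgt (leq_ltn_trans lea (ent_gt _ _ lt0)).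
have nth_mu a : nth 0%N mu a = size [seq e <- nth [::] T a | (e <= p)%N].
  by rewrite -nth_shape nth_T'.
have le_mu a : (nth 0%N mu a <= nth 0%N la a)%N.
  by rewrite nth_mu -shT -nth_shape size_filter count_size.
(* Otherwise an entry above [p] in row [a] would have a box below it, whose entry would exceed
   [p.+1]. *)
have ge_mu a : (a < p)%N -> (nth 0%N la a.+1 <= nth 0%N mu a)%N.
  move=> lta; rewrite leqNgt; apply/negP => lt_mu.
  have := col a _ lt_mu.
  have lt_la := leq_trans lt_mu (dec a).
  have := ent_ge _ _ lt_la; rewrite -nth_mu ltnn => /esym/negbT; rewrite -ltnNge => gt_p.
  by move/(leq_ltn_trans gt_p); rewrite ltnNge le_p.
have mus : mu \in strips la.
  apply: mem_strips => [|a]; rewrite szmu ?szla // => lta.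
  by rewrite ge_mu // le_mu.
have entE i j : (j < nth 0%N mu i)%N -> entry T' i j = entry T i j.
  move=> ltj; rewrite /entry nth_T' [in RHS]rowE nth_cat -nth_mu ltj.
  by [].
apply/allpairsPdep; exists mu, T'; split => //.
  apply/(IH mu T' szmu (sorted_strips mus)); split; last first.
    move=> i j ltj; rewrite entE // -ent_ge -?nth_mu //.
    exact: leq_trans (le_mu i).
  split => // i j ltj.
  - by rewrite entE // pos // (leq_trans ltj).
  - by rewrite !entE ?row // ?(leq_trans ltj) // ltnW.
  - have lt_la := leq_trans ltj (le_mu i.+1).
    rewrite !entE ?col //.
    have [lti|lei] := ltnP i p; first exact: leq_trans lt_la (ge_mu _ lti).
    by move: ltj; rewrite nth_default // szmu leqW.
apply: (@eq_from_nth _ [::]) => [|a lta]; first by rewrite [RHS]size_mkseq.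
rewrite [RHS]nth_mkseq -?szT //= nth_T'. by rewrite szT -rowE.
Qed.

Lemma uniq_strips la : uniq (strips la).
Proof.
elim: la => [|l1 [|l2 t] IH] //.
rewrite [strips _]/=; apply: allpairs_uniq => //; first exact: iota_uniq.
by move=> [m mu] [m' mu'] _ _ [-> ->].
Qed.

(** [restrict] recovers the smaller tableau, and the shape of the latter is [mu]. *)
Lemma uniq_tableaux p la : size la = p -> sorted geq la -> uniq (tableaux p la).
Proof.
elim: p la => [|p IH] la szla srt //.
rewrite [tableaux _ _]/=; apply: allpairs_uniq_dep => [|mu mus|].
- exact: uniq_strips.
- by apply: IH (sorted_strips mus); rewrite (size_strips mus) szla.
have key mu T : mu \in strips la -> T \in tableaux p mu ->
    restrict p (add_strip p.+1 la T) = T.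
  move=> mus Ts.
  have szmu : size mu = p by rewrite (size_strips mus) szla.
  have [[shT _ _ _] le_p] := (mem_tableaux T szmu (sorted_strips mus)).1 Ts.
  have szT : size T = p by rewrite -szmu -shT size_map.
  apply: (@eq_from_nth _ [::]) => [|a]; rewrite size_mkseq ?szT // => lta.
  rewrite nth_mkseq //= nth_mkseq /= ?filter_cat; last exact: ltnW.
  rewrite (_ : filter _ (nseq _ _) = [::]) ?cats0; last first.
    by elim: (_ - _)%N => //= q ->; rewrite ltnn.
  apply/all_filterP/(all_nthP 0%N) => j ltj; apply: le_p.
  by rewrite -shT -nth_shape.
move=> [mu T] [mu' T'] /allpairsPdep[m1 [t1 [ms1 ts1 [e1 e2]]]].
move=> /allpairsPdep[m2 [t2 [ms2 ts2 [e3 e4]]]] /= eT.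
have eTT : T = T'.
  by rewrite e2 e4 -(key _ _ ms1 ts1) -(key _ _ ms2 ts2) -e2 -e4 eT.
have sh m t : m \in strips la -> t \in tableaux p m -> shape t = m.
  move=> ms ts; apply: shape_tableaux ts; last exact: sorted_strips ms.
  by rewrite (size_strips ms) szla.
by rewrite -eTT e1 e3 -(sh _ _ ms1 ts1) -(sh _ _ ms2 ts2) -e2 -e4 eTT.
Qed.

(** * Padding by empty rows *)

Definition pad (la : seq nat) z := la ++ nseq z 0%N.

Lemma nth_pad la z i : nth 0%N (pad la z) i = nth 0%N la i.
Proof.
rewrite nth_cat; case: ltnP => // le; rewrite nth_nseq if_same.
by rewrite nth_default.
Qed.

Lemma sorted_pad la z : sorted geq la -> sorted geq (pad la z).
Proof.
move=> srt; apply/(sortedP 0%N) => i lti; rewrite !nth_pad.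
have [lti'|lei] := ltnP i.+1 (size la); last by rewrite [nth _ la i.+1]nth_default /=.
exact: (sortedP 0%N srt).
Qed.

Lemma entry_pad z T i j : entry (T ++ nseq z [::]) i j = entry T i j.
Proof.
rewrite /entry nth_cat; case: ltnP => // le.
by rewrite nth_nseq if_same (nth_default _ le).
Qed.

Lemma semistandard_pad la z (T : seq (seq nat)) : shape T = la ->
  semistandard (pad la z) (T ++ nseq z [::]) <-> semistandard la T.
Proof.
move=> shT.
have sh : shape (T ++ nseq z [::]) = pad la z.
  by rewrite /shape map_cat -/(shape T) shT map_nseq.
by split=> -[_ pos row col]; split=> // i j; have := (pos i j, row i j, col i j);
  rewrite !nth_pad !entry_pad => -[[]].
Qed.

Lemma shape_padE la z (T : seq (seq nat)) : shape T = pad la z ->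
  exists2 T0, shape T0 = la & T = T0 ++ nseq z [::].
Proof.
move=> shT; exists (take (size la) T).
  by rewrite /shape map_take -/(shape T) shT take_size_cat.
rewrite -[LHS](cat_take_drop (size la)); congr (_ ++ _).
have : shape (drop (size la) T) = nseq z 0%N.
  by rewrite /shape map_drop -/(shape T) shT drop_size_cat.
elim: z {shT} (drop _ T) => [|z IH] [|r s] //= [/size0nil-> /IH ->].
by [].
Qed.

Lemma tableau_weight_pad (R : comNzRingType) (x y : nat -> R) la z T :
  tableau_weight x y (pad la z) (T ++ nseq z [::]) = tableau_weight x y la T.
Proof.
pose F (a : nat) := \prod_(j < nth 0%N la a) (x (entry T a j) + y (entry T a j + j - a)%N).
transitivity (\prod_(i < size (pad la z)) F i).
  by apply: eq_bigr => i _; rewrite nth_pad; apply: eq_bigr => j _; rewrite entry_pad.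
rewrite -(big_mkord xpredT F) /tableau_weight -(big_mkord xpredT F).
have le : (size la <= size (pad la z))%N by rewrite size_cat leq_addr.
rewrite (big_cat_nat (leq0n _) le) /= [X in _ * X]big1_seq ?mulr1 // => i.
rewrite mem_index_iota /= => /andP[lei _].
by rewrite /F [nth 0%N la i]nth_default // big_ord0.
Qed.

(** Tableaux with an entry above [N] have weight [0], which leaves finitely many. The enumeration by
    [tableaux] uses as many rows as variables, whence the padding of [la]; [ts] cuts the empty rows
    off again. *)
Lemma super_schur_poly_gt_sum k m la : sorted geq la ->
  super_schur_poly k m la =
  gt_sum (@schur_x k m) (@schur_y k m) (k + m + size la) (pad la (k + m)).
Proof.
move=> srt; set N := (k + m + size la)%N; set z := (k + m)%N.
have szp : size (pad la z) = N by rewrite size_cat size_nseq addnC.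
have srtp := sorted_pad z srt.
pose ts := [seq take (size la) T | T <- tableaux N (pad la z)].
have unpad T : T \in tableaux N (pad la z) ->
    [/\ shape (take (size la) T) = la & T = take (size la) T ++ nseq z [::]].
  case/(mem_tableaux T szp srtp) => -[/shape_padE[T0 shT0 ->] _ _ _] _.
  have -> : size la = size T0 by rewrite -shT0 size_map.
  by rewrite take_size_cat // shT0.
have ts_semi T : T \in ts -> semistandard la T.
  case/mapP => T1 T1s ->; have [sh eT1] := unpad T1 T1s.
  apply/(semistandard_pad z sh); rewrite -eT1.
  by case/(mem_tableaux T1 szp srtp): T1s.
have uniq_ts : uniq ts.
  rewrite map_inj_in_uniq ?uniq_tableaux // => T1 T2 T1s T2s eT.
  by have [_ ->] := unpad _ T1s; have [_ ->] := unpad _ T2s; rewrite eT.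
rewrite /super_schur_poly /super_schur.
rewrite -(@fsbig_widen _ _ _ _ [set` ts]%classic); first last.
- move=> T [/= semT]; apply: contra_notP => wT.
  have shT : shape T = la by case: semT.
  apply/mapP; exists (T ++ nseq z [::]); last first.
    by rewrite take_size_cat // -shT size_map.
  apply/(mem_tableaux _ szp srtp); split; first exact/(semistandard_pad z shT).
  move=> i j; rewrite nth_pad => ltj; rewrite leqNgt; apply/negP => big.
  apply: wT; apply: (@tableau_weight_eq0 k m la T i j) => //.
    by rewrite ltnNge; apply/negP => le; rewrite nth_default in ltj.
  by move: big; rewrite entry_pad.
- by move=> T /ts_semi.
rewrite -fsbig_seq // -sum_tableaux // big_map; apply: eq_big_seq => T Ts.
by have [_ eT] := unpad T Ts; rewrite [in RHS]eT tableau_weight_pad.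
Qed.

(** * Specialization and positivity of the pattern sums *)

Lemma gt_sum_morph (R R' : comNzRingType) (f : {rmorphism R -> R'}) x y p la :
  f (gt_sum x y p la) = gt_sum (f \o x) (f \o y) p la.
Proof.
elim: p la => [|p IH] la /=; first by rewrite rmorph1.
rewrite rmorph_sum; apply: eq_bigr => mu _; rewrite rmorphM IH; congr (_ * _).
rewrite rmorph_prod; apply: eq_bigr => a _; rewrite rmorph_prod.
by apply: eq_bigr => j _; rewrite rmorphD.
Qed.

Lemma eq_gt_sum (R : comNzRingType) (x x' y y' : nat -> R) p la :
  x =1 x' -> y =1 y' -> gt_sum x y p la = gt_sum x' y' p la.
Proof. by move=> /funext -> /funext ->. Qed.

Lemma gt_sum_ge0 (R : numDomainType) (x y : nat -> R) p la :
  (forall i, 0 <= x i) -> (forall i, 0 <= y i) -> 0 <= gt_sum x y p la.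
Proof.
move=> x0 y0; elim: p la => //= p IH la.
apply: sumr_ge0 => mu _; apply: mulr_ge0 => //.
by apply: prodr_ge0 => a _; apply: prodr_ge0 => j _; exact: addr_ge0.
Qed.

Lemma gt_sum_gt0 (R : numDomainType) (x y : nat -> R) la :
  (forall i, 0 <= x i) -> (forall i, 0 <= y i) -> sorted geq la ->
  (forall i j, (j < nth 0%N la i)%N -> 0 < x i.+1 + y j.+1) ->
  0 < gt_sum x y (size la) la.
Proof.
move=> x0 y0; elim/last_ind: la => [|la l IH] srt pos; first exact: ltr01.
rewrite size_rcons /=.
(* This term comes from the tableau whose [i]-th row is filled with [i]. *)
have las : la \in strips (rcons la l).
  apply: mem_strips => [|a lta]; first by rewrite size_rcons.
  rewrite [nth _ (rcons la l) a]nth_rcons lta leqnn andbT.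
  have := sortedP 0%N srt a; rewrite size_rcons ltnS [nth _ _ a]nth_rcons lta.
  exact.
have uniq_s := uniq_strips (rcons la l).
rewrite (bigD1_seq la) //=; apply: ltr_wpDr.
  apply: sumr_ge0 => mu _; apply: mulr_ge0; last exact: gt_sum_ge0.
  by apply: prodr_ge0 => a _; apply: prodr_ge0 => j _; exact: addr_ge0.
apply: mulr_gt0; last first.
  apply: IH => [|i j ltj].
    by move: srt; rewrite -cats1; case: (la) => //= a s; rewrite cat_path => /andP[].
  apply: pos; rewrite nth_rcons; case: (ltnP i (size la)) => // le.
  by rewrite nth_default in ltj.
apply: prodr_gt0 => a _; rewrite big_seq; apply: prodr_gt0 => j.
rewrite mem_index_iota nth_rcons => /andP[].
have lta : (a <= size la)%N by rewrite -ltnS -(size_rcons la l).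
(* Only the last row of the diagram meets the strip, and there [y] has index [j.+1]. *)
case: (ltngtP a (size la)) => [|gta|ea].
- by move=> _ le; rewrite ltnNge le.
- by rewrite leqNgt gta in lta.
- move=> _ ltj; rewrite ea size_rcons subSn // subnn add1n.
  by apply: pos; rewrite nth_rcons ltnn eqxx.
Qed.

(** * Positivity and the deformation of the zero variables *)

Section Positive.
Variables (n : nat) (K : fieldType) (f : {rmorphism {mpoly rat[n]} -> K}).
Hypothesis f_inj : injective f.
Local Notation ev1 := (meval (fun=> 1)).

(** The instance of [P] for the tables. Only polynomials are evaluated, as a fraction need not have
    a value at [(1, ..., 1)]. *)
Definition positive_at_ones (z : K) : Prop := exists a b : {mpoly rat[n]},
  [/\ 0 < ev1 a, 0 < ev1 b & z = f a / f b].

Lemma positive_ev1_neq0 a : 0 < ev1 a -> f a != 0.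
Proof.
move=> a0; rewrite -(rmorph0 f) (inj_eq f_inj).
by apply: contraTneq a0 => ->; rewrite meval0 ltxx.
Qed.

Lemma positive_morph a : 0 < ev1 a -> positive_at_ones (f a).
Proof. by move=> a0; exists a, 1; rewrite meval1 ltr01 rmorph1 divr1. Qed.

Lemma positive_neq0 z : positive_at_ones z -> z != 0.
Proof.
case=> a [b [/positive_ev1_neq0 a0 /positive_ev1_neq0 b0 ->]].
by rewrite mulf_neq0 ?invr_neq0.
Qed.

Lemma positiveD z w :
  positive_at_ones z -> positive_at_ones w -> positive_at_ones (z + w).
Proof.
move=> [a [b [a0 b0 ->]]] [c [d [c0 d0 ->]]]; exists (a * d + c * b), (b * d).
split; rewrite ?mevalD ?mevalM ?addr_gt0 ?mulr_gt0 //.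
have := positive_ev1_neq0 b0; have := positive_ev1_neq0 d0.
by rewrite rmorphD !rmorphM /= => d1 b1; rewrite addf_div.
Qed.

Lemma positiveM z w :
  positive_at_ones z -> positive_at_ones w -> positive_at_ones (z * w).
Proof.
move=> [a [b [a0 b0 ->]]] [c [d [c0 d0 ->]]]; exists (a * c), (b * d).
by split; rewrite ?mevalM ?mulr_gt0 // !rmorphM /= mulf_div.
Qed.

Lemma positiveV z : positive_at_ones z -> positive_at_ones z^-1.
Proof. by move=> [a [b [a0 b0 ->]]]; exists b, a; rewrite invf_div. Qed.

Lemma positive_nat c : positive_at_ones c.+1%:R.
Proof.
rewrite -(rmorph_nat f); apply: positive_morph.
by rewrite rmorph_nat ltr0n.
Qed.

Lemma positive_var i : positive_at_ones (f 'X_i).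
Proof. by apply: positive_morph; rewrite mevalXU. Qed.

End Positive.

Section Deformation.
Variable K : fieldType.

(* The variables beyond the [n]-th are deformed from [0] to multiples of a
   parameter ['X], so that [finite_vars X] is recovered at ['X = 0]. *)
Definition deform n (X : 'I_n -> K) (c : nat -> K) (i : nat) : {poly K} :=
  if i is i'.+1 then
    if insub i' is Some t then (X t)%:P else c i' *: 'X
  else 0.

Lemma deformE n (X : 'I_n -> K) (c : nat -> K) (i : nat) :
  (exists t : 'I_n, i = t /\ deform X c i.+1 = (X t)%:P) \/
  ((n <= i)%N /\ deform X c i.+1 = c i *: 'X).
Proof.
rewrite /deform; case: insubP => [t _ <-|nlt]; first by left; exists t.
by right; rewrite leqNgt.
Qed.

Lemma deform_horner n (X : 'I_n -> K) (c : nat -> K) i :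
  (deform X c i).[0] = finite_vars X i.
Proof.
case: i => [|i]; rewrite /= ?horner0 //.
by case: insubP => [t _ _|_] /=; rewrite ?hornerC // hornerZ hornerX mulr0.
Qed.

End Deformation.

Lemma horner_gt_sum (K : fieldType) (x y : nat -> {poly K}) p la :
  (gt_sum x y p la).[0] =
  gt_sum (fun i => (x i).[0]) (fun i => (y i).[0]) p la.
Proof. exact: (gt_sum_morph (horner_eval 0)). Qed.

(** At the point of ones, [gt_sum_gt0] asks for [i < k] or [j < m] at the box in row [i] and column
    [j]. If [i >= k], then [la] has more than [k] parts, the bound forces [head 0 la <= 1], and so
    [j = 0 < m]. *)
Lemma super_schur_poly_gt0 k m la : (0 < m)%N -> sorted geq la ->
  (head 0 la + size la <= k + 2)%N ->
  0 < (super_schur_poly k m la).@[fun=> 1].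
Proof.
move=> m0 srt hook; rewrite super_schur_poly_gt_sum //.
have fv n (X : 'I_n -> {mpoly rat[k + m]}) i : (forall t, (X t).@[fun=> 1] = 1) ->
    (finite_vars X i).@[fun=> 1] = (0 < i <= n)%:R.
  move=> X1; case: i => [|i] /=; first by rewrite meval0.
  by case: insubP => [t lti _|/negPf nlt] /=; rewrite ?X1 ?lti ?meval0 ?nlt.
have -> : (k + m + size la = size (pad la (k + m)))%N by rewrite size_cat size_nseq addnC.
have fvx i : (meval (fun=> 1) \o @schur_x k m) i = (0 < i <= k)%:R :> rat.
  by rewrite /= fv // => t; rewrite mevalXU.
have fvy i : (meval (fun=> 1) \o @schur_y k m) i = (0 < i <= m)%:R :> rat.
  by rewrite /= fv // => t; rewrite mevalXU.
rewrite (gt_sum_morph (meval (fun=> 1))); apply: gt_sum_gt0.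
- by move=> i; rewrite fvx ler0n.
- by move=> i; rewrite fvy ler0n.
- exact: sorted_pad.
move=> i j; rewrite nth_pad fvx fvy -natrD ltr0n /= => ltj.
have lti : (i < size la)%N by rewrite ltnNge; apply/negP => le; rewrite nth_default in ltj.
have le_head : (nth 0%N la i <= head 0%N la)%N.
  elim: i ltj lti => [|i IH] ltj lti; first by rewrite nth0.
  have le := sortedP 0%N srt _ lti.
  exact: leq_trans le (IH (leq_trans ltj le) (ltnW lti)).
case: (ltnP i k) => [//|leik]; case: (ltnP j m) => // lemj.
by lia.
Qed.

(** * The circuit for the super-Schur polynomial *)

Section DoubleSchur.
Variables (k m : nat) (K : fieldType) (f : {rmorphism {mpoly rat[k + m]} -> K}).
Hypothesis f_inj : injective f.
Local Notation pos := (positive_at_ones f).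

Let v (i : 'I_(k + m)) : K := f 'X_i.
Let vx (i : 'I_k) : K := v (lshift m i).
Let vy (j : 'I_m) : K := v (rshift k j).
(** Distinct coefficients keep the deformed [x] distinct, as the three-term relation requires; as
    positive integers they lead to scalars that a circuit may use. *)
Let cx (i : nat) : K := i.+1%:R.
Let x : nat -> {poly K} := deform vx cx.
Let y : nat -> {poly K} := deform vy (fun=> 1).

Lemma var_inj : injective v.
Proof.
move=> i j /f_inj.
move/(congr1 (meval (fun l => (l == i)%:R))); rewrite !mevalXU eqxx.
by case: eqP => // _ /eqP; rewrite oner_eq0.
Qed.

Lemma nat_neq0 c : (c.+1%:R : K) != 0.
Proof. exact/(positive_neq0 f_inj)/positive_nat. Qed.

Lemma deform_x_neq i j : (0 < j < i)%N -> x j != x i.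
Proof.
case: i j => [|i] [|j] // ltSS; have ltji : (j < i)%N := ltSS; apply/eqP.
rewrite /x.
case: (deformE vx cx j) => [[s [ej ->]]|[lej ->]];
case: (deformE vx cx i) => [[t [ei ->]]|[lei ->]].
- move/polyC_inj/var_inj/lshift_inj => st; move: ltji.
  by rewrite ej ei st ltnn.
- move/(congr1 (fun p : {poly K} => p`_1)); rewrite coefC coefZ coefX mulr1 => /esym/eqP.
  exact/negP/nat_neq0.
- by move: ltji; have := ltn_ord t; rewrite -ei; lia.
- move/(congr1 (fun p : {poly K} => p`_1)).
  rewrite !coefZ coefX !mulr1 /cx -[j.+1%:R]natr1 -[i.+1%:R]natr1 => /addIr e.
  have := nat_neq0 (i - j).-1; rewrite prednK ?subn_gt0 // natrB ?(ltnW ltji) //.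
  by rewrite e subrr eqxx.
Qed.

(** The lowest coefficient is a sum of two variables, one variable or the scalar [i.+2], according
    to how many of the two terms are deformed; only the sum costs a gate. *)
Lemma low_deform_sum i j :
  pos (low_coef (x i.+1 + y j.+1)) /\
  exists2 e, (e <= 1)%N & derivable
    (fun z => (exists i, z = v i) \/ exists c, z = c.+1%:R) e
    (low_coef (x i.+1 + y j.+1)).
Proof.
have v0 t : v t != 0 by apply/(positive_neq0 f_inj)/positive_var.
have vx0 s : vx s != 0 := v0 _.
have vy0 t : vy t != 0 := v0 _.
rewrite /x /y.
case: (deformE vx cx i) => [[s [_ ->]]|[_ ->]];
case: (deformE vy (fun=> 1) j) => [[t [_ ->]]|[_ ->]].
- rewrite -polyCD low_coefC; split; first by apply: positiveD => //; exact: positive_var.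
  exists 1 => //; apply: (@DerOp _ _ OpAdd _ _ _ 0 0) => //.
    by apply: DerIn; left; eexists.
  by apply: DerIn; left; eexists.
- have e0 : ((vx s)%:P + 1 *: 'X).[0] = vx s.
    by rewrite hornerD hornerC hornerZ hornerX mulr0 addr0.
  rewrite low_coef_horner e0 //; split; first exact: positive_var.
  by exists 0%N => //; apply: DerIn; left; eexists.
- have e0 : (cx i *: 'X + (vy t)%:P).[0] = vy t.
    by rewrite hornerD hornerC hornerZ hornerX mulr0 add0r.
  rewrite low_coef_horner e0 //; split; first exact: positive_var.
  by exists 0%N => //; apply: DerIn; left; eexists.
- have -> : cx i *: 'X + 1 *: 'X = (i.+2%:R)%:P * 'X^1 :> {poly K}.
    by rewrite -scalerDl /cx natr1 -mul_polyC expr1.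
  rewrite low_coefE hornerC ?nat_neq0 //; split; first exact: positive_nat.
  by exists 0%N => //; apply: DerIn; right; eexists.
Qed.

Lemma super_schur_circuit la : (0 < m)%N -> sorted geq la ->
  (head 0 la + size la <= k + 2)%N ->
  exists C : circuit (k + m),
    [/\ subtraction_free C,
        circuit_eval v C = Some (f (super_schur_poly k m la))
      & (circuit_size C <= let N := (head 0 la + (k + m + size la))%N in
           4 * (N.+1 * N.+1) + 4 * (N * N) * N)%N].
Proof.
move=> m0 srt hook; set N := (head 0 la + _)%N; set p := (k + m + size la)%N.
have szp : size (pad la (k + m)) = p by rewrite size_cat size_nseq addnC.
pose I := staircase (pad la (k + m)).
have srtI : sorted gtn I by exact/sorted_staircase/sorted_pad.
(* The list is decreasing and starts with [head 0 la + p.-1], which is [N.-1]. *)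
have ltI : all (fun i => (i < N)%N) I.
  have p0 : (0 < p)%N by rewrite /p; lia.
  have hd : head 0%N I = (head 0 la + p.-1)%N.
    rewrite /I -szp /pad; case: (la) => [|a s] //=.
    by case: (k + m)%N.
  apply/allP => i Ii.
  have [a [s eI]] : exists a s, I = a :: s.
    by case: (I) Ii => // a s _; exists a, s.
  have le : (i <= a)%N.
    move: Ii srtI; rewrite eI inE => /orP[/eqP->//|is_] /= pth.
    exact: ltnW (allP (order_path_min (rev_trans ltn_trans) pth) _ is_).
  by move: hd; rewrite eI /= => ea; apply: leq_ltn_trans le _; rewrite ea /N; lia.
have schurE : schur_of x y I = gt_sum x y p (pad la (k + m)).
  by rewrite /schur_of /I staircaseK size_staircase szp.
have at0 : (schur_of x y I).[0] = f (super_schur_poly k m la).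
  rewrite schurE horner_gt_sum super_schur_poly_gt_sum //.
  rewrite (gt_sum_morph f); apply: eq_gt_sum => i /=.
    rewrite deform_horner; case: i => [|i] /=; first by rewrite rmorph0.
    by case: insub => [t|] //=; rewrite rmorph0.
  rewrite deform_horner; case: i => [|i] /=; first by rewrite rmorph0.
  by case: insub => [t|] //=; rewrite rmorph0.
have lowE : low_coef (schur_of x y I) = f (super_schur_poly k m la).
  by rewrite low_coef_horner at0 // positive_ev1_neq0 // super_schur_poly_gt0.
have [_ cmp] := computable_low_schur (positive_neq0 f_inj) (positive_nat f 0)
  (positiveD f_inj) (@positiveM _ _ f) (@positiveV _ _ f) deform_x_neq
  (fun i j => (low_deform_sum i j).1) (fun i j => (low_deform_sum i j).2) srtI ltI.
have [C [sf ev sz]] := computable_circuit cmp (esym lowE).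
by exists C.
Qed.

End DoubleSchur.

Lemma tofrac_injective n : injective (@tofrac {mpoly rat[n]}).
Proof. by move=> p q /eqP; rewrite tofrac_eq => /eqP. Qed.

Theorem theorem4p4 :
  exists c : nat,
    forall (k m : nat) (la : seq nat),
      (1 <= k)%N -> (1 <= m)%N ->
      is_partition la ->
      (head 0 la + size la <= k + 2)%N ->
      exists C : circuit (k + m),
        [/\ subtraction_free C,
            computes C (tofrac (super_schur_poly k m la))
          & (circuit_size C <= c * (k + m) ^ 3)%N].
Proof.
(* With [s = k + m], the bound on [head 0 la + size la] gives [N.+1 <= 4 * s]; the size is then at
   most [64 * s ^ 2 + 256 * s ^ 3], which is below [1000 * s ^ 3]. *)
exists 1000 => k m la k0 m0 /andP[srt _] hook.
have [C [sf ev sz]] :=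
  super_schur_circuit (f := @tofrac {mpoly rat[k + m]}) (@tofrac_injective _) m0 srt hook.
exists C; split => //; apply: leq_trans sz _.
set N := (head 0 la + _)%N; set s := (k + m)%N.
have s2 : (2 <= s)%N by rewrite /s; lia.
have leN : (N.+1 <= 4 * s)%N by rewrite /N /s; lia.
rewrite /=.
apply: (@leq_trans (4 * (4 * s * (4 * s)) + 4 * (4 * s * (4 * s)) * (4 * s))).
  by apply: leq_add; [|apply: leq_mul; [|exact: ltnW]];
     rewrite leq_mul2l; apply: leq_mul => //; exact: ltnW.
rewrite !expnS expn0 muln1.
nia.
Qed.
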